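(* Let $a,b\in\mathbb{P}$, $(\alpha,\beta)\in\mathrm{BP}(a,b)$ and $l\in\mathbb{N}$. Let $\prec_{b-a}$ be any $(b-a)$-order on $\mathbb{Z}$, so that $(L_{b-a},\prec_{b-a})$ is a complete ordering pair. Then the induced mapping $\Theta_{(L_{b-a},\prec_{b-a})}$ is a bijection from $\mathrm{VOS}(a,b,\alpha,\beta,l)$ to $\mathrm{GOT}([\min(a,b)],\prec_{b-a},\lambda_{a,b,\alpha,\beta},l)$, and the inverse mapping is $\Phi_{b-a}$.
   Context: Notation: $\mathbb{P}$ is the set of positive integers, $\mathbb{N}$ the set of nonnegative integers, $[m,n]=\{m,m+1,\ldots,n\}$ ($=\emptyset$ if $n<m$), $[n]=[1,n]$. Osculating paths. For $a,b\in\mathbb{P}$, $[a]\times[b]$ is a rectangle of lattice points with matrix labelling ($(i,j)$ is in row $i$ from the top and column $j$ from the left). $\mathrm{BP}(a,b)$ is the set of pairs $(\alpha,\beta)$ with $\alpha\subset[a]$, $\beta\subset[b]$, $|\alpha|=|\beta|$; elements are labelled in increasing order, $\alpha=\{\alpha_1<\ldots<\alpha_r\}$, $\beta=\{\beta_1<\ldots<\beta_r\}$. For $x\in[a]$, $y\in[b]$, $\Pi(a,b,x,y)$ is the set of paths $Q=(Q_0,\ldots,Q_L)$ with $Q_0=(a,y)$, $Q_L=(x,b)$ and each step $Q_m-Q_{m-1}\in\{(0,1),(-1,0)\}$. For $x<x'$ and $y<y'$, paths $Q\in\Pi(a,b,x,y)$ and $Q'\in\Pi(a,b,x',y')$ are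 osculating if whenever $Q_m=Q'_{m'}=(i,j)$, then $Q_{m-1}=(i,j-1)$, $Q_{m+1}=(i-1,j)$, $Q'_{m'-1}=(i+1,j)$ (unless $m'=0$) and $Q'_{m'+1}=(i,j+1)$ (unless $Q'_{m'}$ is the last point of $Q'$). $\mathrm{OP}(a,b,\alpha,\beta)$ is the set of $r$-tuples $P=(P_1,\ldots,P_r)$ with $P_k\in\Pi(a,b,\alpha_k,\beta_k)$ and $P_k,P_{k+1}$ osculating for each $k\in[r-1]$. A vacancy of $P$ is a point of $[a]\times[b]$ on no path of $P$; an osculation of $P$ is a point on two paths of $P$. $Z(P)$ is the set of all vacancies and osculations of $P$. $\mathrm{OP}(a,b,\alpha,\beta,l)$ is the set of $P\in\mathrm{OP}(a,b,\alpha,\beta)$ with $|Z(P)|=l$, and $\mathrm{VOS}(a,b,\alpha,\beta,l)=\{Z(P)\mid P\in\mathrm{OP}(a,b,\alpha,\beta,l)\}$. Partitions. A partition is a weakly decreasing infinite sequence $\lambda=(\lambda_1,\lambda_2,\ldots)$ of nonnegative integers with finitely many nonzero terms; $\ell(\lambda)$ is the number of nonzero terms, $|\lambda|$ the sum, $\lambda^t$ the conjugate, $Y(\lambda)=\{(i,j)\in\mathbb{P}^2\mid i\le\ell(\lambda),\,j\le\lambda_i\}$, and $\emptyset$ is the empty partition. For integers $\gamma_1>\ldots>\gamma_r\ge0$ and $\delta_1>\ldots>\delta_r\ge0$, $(\gamma_1,\ldots,\gamma_r\,|\,\delta_1,\ldots,\delta_r)$ (Frobenius notation) is the unique partition $\lambda$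 with exactly $r$ indices $i$ satisfying $\lambda_i\ge i$, and with $\lambda_i-i=\gamma_i$, $\lambda^t_i-i=\delta_i$ for $i\in[r]$. For $\lambda$ with $\ell(\lambda)\le a$ and $\lambda_1\le b$, $[a]\times[b]\setminus\lambda:=(b-\lambda_a,b-\lambda_{a-1},\ldots,b-\lambda_1)$. For $(\alpha,\beta)\in\mathrm{BP}(a,b)$, $\lambda_{a,b,\alpha,\beta}:=[a]\times[b]\setminus(b-\beta_1,\ldots,b-\beta_r\,|\,a-\alpha_1,\ldots,a-\alpha_r)$. Partitions $\lambda,\mu$ differ by a square, $\lambda\sim\mu$, if one of $Y(\lambda),Y(\mu)$ is the disjoint union of the other and a single point $(i,j)$; then $\Delta(\lambda,\mu):=j-i$. Oscillating tableaux. $\mathrm{OT}(\lambda,l)$ is the set of sequences $\eta=(\eta_0=\emptyset,\eta_1,\ldots,\eta_l=\lambda)$ of partitions with $\eta_{k-1}\sim\eta_k$ for $k\in[l]$ (shape $\lambda$, length $l$). The profile of $\eta$ is $\Omega(\eta)=(\Omega(\eta)_1,\ldots,\Omega(\eta)_l)$ with $\Omega(\eta)_k=\Delta(\eta_{k-1},\eta_k)$; it determines $\eta$ uniquely. For $T\subset\mathbb{P}$ and a strict total order $\prec$ on $\mathbb{Z}$, $\mathrm{GOT}(T,\prec,\lambda,l)$ is the set of pairs $(t,\eta)\in T^l\times\mathrm{OT}(\lambda,l)$, $t=(t_1,\ldots,t_l)$, such that for each $k\in[l-1]$ either $t_k<t_{k+1}$, or $t_k=t_{k+1}$ and $\Omega(\eta)_k\prec\Omega(\eta)_{k+1}$.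 Ordering pairs. An ordering pair $(L,\prec)$ is a function $L:\mathbb{P}^2\to\mathbb{P}$ and a strict total order $\prec$ on $\mathbb{Z}$ such that, for all $(i,j),(i',j')\in\mathbb{P}^2$: if $L(i,j)<L(i',j')$, or $L(i,j)=L(i',j')$ and $j-i\prec j'-i'$, then $i<i'$ or $j<j'$. For $S\in\mathrm{VOS}(a,b,\alpha,\beta,l)$, the progression for $S$ induced by $(L,\prec)$ is the unique ordering $s=(s_1,\ldots,s_l)=((i_1,j_1),\ldots,(i_l,j_l))$ of $S$ such that for each $k\in[l-1]$, $L(i_k,j_k)<L(i_{k+1},j_{k+1})$, or $L(i_k,j_k)=L(i_{k+1},j_{k+1})$ and $j_k-i_k\prec j_{k+1}-i_{k+1}$. There is a unique oscillating tableau $\eta(s)$ of shape $\lambda_{a,b,\alpha,\beta}$ and length $l$ with profile $(j_1-i_1,\ldots,j_l-i_l)$, and $\Theta_{(L,\prec)}(S):=((L(s_1),\ldots,L(s_l)),\eta(s))$. Complete ordering pairs. For $q\in\mathbb{Z}$, $L_q(i,j)=\max(i+q,j)$ if $q\le0$ and $L_q(i,j)=\max(i,j-q)$ if $q\ge0$. A $q$-order is a strict total order $\prec_q$ on $\mathbb{Z}$ such that $z\prec_q z'$ whenever $z<z'\le q$ or $z>z'\ge q$. For any $q$-order $\prec_q$, $(L_q,\prec_q)$ is an ordering pair, called a complete ordering pair. For $q,u,z\in\mathbb{Z}$ define $G_q(u,z)=(u-z,u)$ if $q\le\min(0,z)$; $(u-q,u-q+z)$ if $z\le q\le0$; $(u+q-z,u+q)$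 if $0\le q\le z$; $(u,u+z)$ if $q\ge\max(0,z)$. For a generalized oscillating tableau $(t,\eta)$ of length $l$, $\Phi_q(t,\eta):=\{G_q(t_1,\Omega(\eta)_1),\ldots,G_q(t_l,\Omega(\eta)_l)\}$. *)

(* Defs.v *)
From HB Require Import structures.
From mathcomp Require Import all_boot all_order all_algebra finmap.
From mathcomp Require Import boolp classical_sets functions.
From mathcomp Require Import zify.

Set Implicit Arguments.
Unset Strict Implicit.
Unset Printing Implicit Defensive.

Import Order.TTheory GRing.Theory Num.Theory.

Local Open Scope classical_set_scope.
Local Open Scope ring_scope.

(* Lattice points carry integer coordinates (row, column), rows being numbered
   from the top; all numberings start at 1, as in matrices.  Positive integers
   are the elements z of int with 0 < z.  "The unique x with P x" is
   rendered by [xget x0 P], which satisfies P as soon as some x does and is the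
   (irrelevant) default x0 otherwise. *)
Definition lattice_pt : Type := (int * int)%type.

Definition bracket (n : nat) : {fset int} := [fset k%:Z | k in iota 1 n]%fset.

Definition grid (a b : nat) : {fset lattice_pt} := (bracket a `*` bracket b)%fset.

Definition BP (a b : nat) : set ({fset int} * {fset int}) :=
  [set ab | [/\ (ab.1 `<=` bracket a)%fset, (ab.2 `<=` bracket b)%fset
              & #|` ab.1| = #|` ab.2| ] ].

(* The elements of A in increasing order; A_(k+1) is [(labelled A)`_k]. *)
Definition labelled (A : {fset int}) : seq int := sort <=%R (A : seq int).

Definition lattice_step (p p' : lattice_pt) : bool :=
  (p' == (p.1, p.2 + 1)) || (p' == (p.1 - 1, p.2)).

Definition Pi (a b : nat) (x y : int) : set (seq lattice_pt) :=
  [set Q | exists Q0 Q', [/\ Q = Q0 :: Q', Q0 = (a%:Z, y),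
                             last Q0 Q' = (x, b%:Z) & path lattice_step Q0 Q'] ].

Definition osculating (Q Q' : seq lattice_pt) : Prop :=
  let pt := nth ((0, 0) : lattice_pt) in
  forall (m m' : nat) (i j : int), (m < size Q)%N -> (m' < size Q')%N ->
    pt Q m = (i, j) -> pt Q' m' = (i, j) ->
    [/\ (0 < m)%N /\ pt Q m.-1 = (i, j - 1),
        (m.+1 < size Q)%N /\ pt Q m.+1 = (i - 1, j),
        (0 < m')%N -> pt Q' m'.-1 = (i + 1, j)
      & (m'.+1 < size Q')%N -> pt Q' m'.+1 = (i, j + 1)].

Definition OP (a b : nat) (alpha beta : {fset int}) : set (seq (seq lattice_pt)) :=
  [set P | [/\ size P = #|` alpha|,
      forall k, (k < size P)%N ->
        Pi a b (labelled alpha)`_k (labelled beta)`_k (nth [::] P k)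
    & forall k, (k.+1 < size P)%N ->
        osculating (nth [::] P k) (nth [::] P k.+1)] ].

Definition paths_through (P : seq (seq lattice_pt)) (p : lattice_pt) : nat :=
  count (fun Q : seq lattice_pt => p \in Q) P.

Definition vacancies (a b : nat) (P : seq (seq lattice_pt)) : {fset lattice_pt} :=
  [fset p in grid a b | paths_through P p == 0%N]%fset.

Definition osculations (a b : nat) (P : seq (seq lattice_pt)) : {fset lattice_pt} :=
  [fset p in grid a b | (2 <= paths_through P p)%N]%fset.

Definition Zset (a b : nat) (P : seq (seq lattice_pt)) : {fset lattice_pt} :=
  (vacancies a b P `|` osculations a b P)%fset.

Definition OPl (a b : nat) (alpha beta : {fset int}) (l : nat) :
    set (seq (seq lattice_pt)) :=
  [set P | OP a b alpha beta P /\ #|` Zset a b P| = l].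

Definition VOS (a b : nat) (alpha beta : {fset int}) (l : nat) :
    set {fset lattice_pt} :=
  [set Zset a b P | P in OPl a b alpha beta l].

(* An integer partition, an infinite sequence, is stored as the list of its
   nonzero terms; [term lam i] is lambda_i and [conj_term lam j] is the j-th
   term of the conjugate, for i, j >= 1. *)
Definition is_int_partition (s : seq nat) : bool := sorted geq s && (0%N \notin s).

Record int_partition := IntPartition {
  parts :> seq nat;
  partsP : is_int_partition parts }.

HB.instance Definition _ := [isSub for parts].
HB.instance Definition _ := [Choice of int_partition by <:].

Definition empty_part : int_partition := @IntPartition [::] isT.

Definition term (lam : int_partition) (i : nat) : nat := nth 0%N lam i.-1.

Definition conj_term (lam : int_partition) (j : nat) : nat :=
  count (fun x => (j <= x)%N) lam.

Definition Y (lam : int_partition) : set lattice_pt :=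
  [set p | exists i j : nat, p = (i%:Z, j%:Z) /\
     ((1 <= i <= size lam)%N /\ (1 <= j <= term lam i)%N)].

(* The indices i with i <= lambda_i are at most the number of nonzero terms. *)
Definition frobenius_spec (gamma delta : seq int) : set int_partition :=
  [set lam |
     count (fun i => (i <= term lam i)%N) (iota 1 (size lam)) = size gamma /\
     forall i : nat, (1 <= i <= size gamma)%N ->
       (term lam i)%:Z - i%:Z = gamma`_i.-1 /\
       (conj_term lam i)%:Z - i%:Z = delta`_i.-1].

Definition frobenius (gamma delta : seq int) : int_partition :=
  xget empty_part (frobenius_spec gamma delta).

Definition complement_terms (a b : nat) (lam : int_partition) : seq nat :=
  [seq (b - term lam (a.+1 - i))%N | i <- iota 1 a].

Lemma complement_subproof (a b : nat) (lam : int_partition) :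
  is_int_partition [seq x <- complement_terms a b lam | (0 < x)%N].
Proof.
apply/andP; split; last by rewrite mem_filter.
apply: sorted_filter; first by move=> x y z /= h1 h2; exact: leq_trans h2 h1.
have /andP[slam _] := partsP lam.
apply/(sortedP 0%N) => k; rewrite size_map size_iota => hk.
have hk' := ltnW hk.
rewrite !(nth_map 0%N) ?size_iota // !nth_iota // /geq /=.
apply: leq_sub2l; rewrite /term.
have [ha|ha] := ltnP (a.+1 - (1 + k)).-1 (size lam); last by rewrite nth_default.
apply: (sorted_leq_nth (leT := geq)) => //.
- by move=> x y z /= h1 h2; exact: leq_trans h2 h1.
- by move=> x /=.
- by rewrite inE; lia.
- lia.
Qed.

(* [a] x [b] \ lambda, meaningful when lambda has at most a nonzero terms and
   lambda_1 <= b. *)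
Definition complement (a b : nat) (lam : int_partition) : int_partition :=
  IntPartition (complement_subproof a b lam).

Definition lambda_ (a b : nat) (alpha beta : {fset int}) : int_partition :=
  complement a b (frobenius [seq b%:Z - y | y <- labelled beta]
                            [seq a%:Z - x | x <- labelled alpha]).

Definition differ_at (lam mu : int_partition) : set lattice_pt :=
  [set p | (~ Y lam p /\ Y mu = Y lam `|` [set p]) \/
           (~ Y mu p /\ Y lam = Y mu `|` [set p])].

Definition differ_by_square (lam mu : int_partition) : Prop :=
  exists p, differ_at lam mu p.

Definition Delta (lam mu : int_partition) : int :=
  let p := xget (0, 0) (differ_at lam mu) in p.2 - p.1.

Definition OT (lam : int_partition) (l : nat) : set (seq int_partition) :=
  let sh := nth empty_part in
  [set eta | [/\ size eta = l.+1, sh eta 0%N = empty_part, sh eta l = lam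
      & forall k, (1 <= k <= l)%N -> differ_by_square (sh eta k.-1) (sh eta k)] ].

Definition profile (eta : seq int_partition) : seq int :=
  let sh := nth empty_part in
  [seq Delta (sh eta k.-1) (sh eta k) | k <- iota 1 (size eta).-1].

Definition strict_total_order (prec : rel int) : Prop :=
  [/\ irreflexive prec, transitive prec
    & forall z z', z != z' -> prec z z' || prec z' z].

Definition GOT (T : set int) (prec : rel int) (lam : int_partition) (l : nat) :
    set (seq int * seq int_partition) :=
  [set te | let: (t, eta) := te in
     [/\ size t = l, forall k, (k < l)%N -> T t`_k, OT lam l eta
       & forall k, (k.+1 < l)%N ->
           t`_k < t`_k.+1 \/
           t`_k = t`_k.+1 /\ prec (profile eta)`_k (profile eta)`_k.+1] ].

(* (L(p), j - i) precedes (L(p'), j' - i') lexicographically. *)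
Definition point_lt (L : lattice_pt -> int) (prec : rel int) (p p' : lattice_pt) : bool :=
  (L p < L p') || ((L p == L p') && prec (p.2 - p.1) (p'.2 - p'.1)).

(* Only the values of L on pairs of positive integers matter. *)
Definition ordering_pair (L : lattice_pt -> int) (prec : rel int) : Prop :=
  [/\ strict_total_order prec,
      forall p : lattice_pt, 0 < p.1 -> 0 < p.2 -> 0 < L p
    & forall p p' : lattice_pt, 0 < p.1 -> 0 < p.2 -> 0 < p'.1 -> 0 < p'.2 ->
        point_lt L prec p p' -> p.1 < p'.1 \/ p.2 < p'.2].

Definition progression (L : lattice_pt -> int) (prec : rel int) (S : {fset lattice_pt}) :
    seq lattice_pt :=
  xget [::] [set s : seq lattice_pt | perm_eq s S /\ sorted (point_lt L prec) s].

(* eta(s) for a sequence s of points and the shape lam. *)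
Definition tableau_of (lam : int_partition) (s : seq lattice_pt) : seq int_partition :=
  xget [::] [set eta | OT lam (size s) eta /\
                       profile eta = [seq p.2 - p.1 | p <- s] ].

Definition Theta (a b : nat) (alpha beta : {fset int})
    (L : lattice_pt -> int) (prec : rel int) (S : {fset lattice_pt}) :
    seq int * seq int_partition :=
  let s := progression L prec S in
  (map L s, tableau_of (lambda_ a b alpha beta) s).

Definition Lq (q : int) (p : lattice_pt) : int :=
  if q <= 0 then Num.max (p.1 + q) p.2 else Num.max p.1 (p.2 - q).

Definition q_order (q : int) (prec : rel int) : Prop :=
  strict_total_order prec /\
  forall z z' : int, (z < z' <= q) || (q <= z' < z) -> prec z z'.

Lemma complete_ordering_pair (q : int) (prec : rel int) :
  q_order q prec -> ordering_pair (Lq q) prec.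
Proof.
move=> [sto qo]; split=> // [[i j]|[i j] [i' j']] /=.
  by rewrite /Lq /=; case: ifP; lia.
have [irr tr _] := sto.
move=> hi hj hi' hj'; rewrite /point_lt /Lq /= => h.
suff : ~~ [&& i' <= i & j' <= j] by lia.
apply/negP => /andP[le_i le_j].
have hle d d' : prec d d' -> ~~ prec d' d.
  by move=> h1; apply/negP => h2; move: (tr _ _ _ h1 h2); rewrite irr.
have := qo (j' - i') (j - i).
have := hle (j - i) (j' - i').
have e0 : j - i = j' - i' -> prec (j - i) (j' - i') = false.
  by move=> ->; rewrite irr.
move: h e0; case: (prec _ _); case: (prec _ _); case: ifP => hq; lia.
Qed.

(* The four cases overlap consistently and cover all q, z; the last one is
   max(0, z) <= q. *)
Definition Gq (q u z : int) : lattice_pt :=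
  if q <= Num.min 0 z then (u - z, u)
  else if (z <= q) && (q <= 0) then (u - q, u - q + z)
  else if (0 <= q) && (q <= z) then (u + q - z, u + q)
  else (u, u + z).

Definition Phi (q : int) (te : seq int * seq int_partition) : {fset lattice_pt} :=
  [fset Gq q uz.1 uz.2 | uz in zip te.1 (profile te.2)]%fset.

(* Main.v *)
(* Let F(i,j) be the number of points of paths on the diagonal of (i,j), weakly
   north-west of (i,j).  Each path meets a diagonal at most once, so F counts the
   paths passing north-west of (i,j), and F(i,j) - F(i-1,j-1) is the number of
   paths through (i,j).  Tuples of osculating paths thereby correspond to
   functions F growing by 0 or 1 along each unit step, with boundary values
   F(a,j) = #{beta_k <= j} and F(i,b) = #{alpha_k <= i}: the k-th path is the
   border of the region F >= k.

   A partition is encoded by the numbers d_c of its boxes on the diagonals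
   j - i = c.  These are the finitely supported d with slopes in {0,-1} for
   c >= 0 and in {0,1} for c < 0, and two partitions differ by a square on the
   diagonal c when their d differ by 1 at c only.

   Let vacancies have sign +1 and osculations sign -1; then min(i,j) - F(i,j) is
   the signed number of points of Z(P) on the diagonal of (i,j), weakly
   north-west of (i,j).  The points of Z(P) which do not come after (i,j) in the
   progression have signed numbers min - F at (i,j), (i-1,j), (i,j-1) on the
   diagonals j-i, j-i+1, j-i-1.  So the 0/1 growth of F is exactly the slope
   condition on the partitions of the tableau.  It remains to see that the points
   G_q(t_k, Omega_k) of a generalized oscillating tableau lie in the rectangle:
   the first box on a diagonal c <> 0 is preceded by a box on the neighbouring
   diagonal towards 0, and the q-order forces the level to grow accordingly. *)

Require Import Defs.
From mathcomp Require Import all_boot all_order all_algebra finmap.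
From mathcomp Require Import boolp classical_sets functions.
From mathcomp Require Import zify.

Set Implicit Arguments.
Unset Strict Implicit.
Unset Printing Implicit Defensive.

Import Order.TTheory GRing.Theory Num.Theory.

Local Open Scope classical_set_scope.
Local Open Scope ring_scope.

(** * Partitions and the numbers of their boxes on diagonals *)

Lemma mem_bracket (n : nat) (x : int) : (x \in bracket n) = (1 <= x <= n%:Z).
Proof.
apply/imfsetP/idP => /= [[k]|hx]; first by rewrite mem_iota => hk ->; lia.
by exists `|x|%N; rewrite ?mem_iota; lia.
Qed.

Lemma mem_grid (a b : nat) (i j : int) :
  ((i, j) \in grid a b) = (1 <= i <= a%:Z) && (1 <= j <= b%:Z).
Proof. by rewrite in_fsetM /= !mem_bracket. Qed.

(** The positive integers satisfying [P] form an initial segment ending by [m], so counting them up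
    to [m] tells where the segment ends. *)
Lemma count_iota_prefix (P : pred nat) (m n : nat) :
  (forall k, (0 < k)%N -> P k.+1 -> P k) -> (forall k, P k -> (k <= m)%N) ->
  (0 < n)%N -> (n <= count P (iota 1 m))%N = P n.
Proof.
move=> Pdown Pm n0.
have Pdown' k d : (0 < k)%N -> P (k + d)%N -> P k.
  elim: d => [|d IH] k0; rewrite ?addn0 // addnS => /Pdown h.
  by apply: IH => //; apply: h; lia.
have [Pn|nPn] := boolP (P n).
  have nm := Pm _ Pn.
  rewrite -(subnKC nm) iotaD count_cat.
  rewrite (_ : count P (iota 1 n) = n) ?leq_addr //.
  rewrite -[RHS](size_iota 1 n); apply/eqP; rewrite -all_count.
  apply/allP => k; rewrite mem_iota => hk.
  by apply: (Pdown' k (n - k)%N); rewrite ?subnKC //; lia.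
have [nm|mn] := leqP n.-1 m; last first.
  by apply/negbTE; rewrite -ltnNge; apply: leq_ltn_trans (count_size _ _) _;
     rewrite size_iota; lia.
rewrite -(subnKC nm) iotaD count_cat.
rewrite [X in (_ + X)%N](_ : _ = 0%N).
  by have := count_size P (iota 1 n.-1); rewrite size_iota addn0; move: (count _ _); lia.
apply/eqP; rewrite -leqn0 leqNgt -has_count; apply/hasPn => k.
rewrite mem_iota => hk; apply: contra nPn => Pk.
by apply: (Pdown' n (k - n)%N); rewrite ?subnKC //; lia.
Qed.

Lemma geq_trans : transitive geq.
Proof. by move=> x y z /= h1 h2; exact: leq_trans h2 h1. Qed.

Lemma term_default (lam : int_partition) (i : nat) :
  (size lam < i)%N -> term lam i = 0%N.
Proof. by move=> h; rewrite /term nth_default //; lia. Qed.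

Lemma term_gt0 (lam : int_partition) (i : nat) :
  (0 < i)%N -> (0 < term lam i)%N = (i <= size lam)%N.
Proof.
move=> i0; have [h|h] := leqP i (size lam); last by rewrite term_default.
have /andP[_ /negP n0] := partsP lam.
rewrite lt0n; apply/negP => /eqP e; apply: n0; rewrite -[X in X \in _]e.
by apply: mem_nth; rewrite prednK.
Qed.

Lemma term_decr (lam : int_partition) (i j : nat) :
  (0 < i)%N -> (i <= j)%N -> (term lam j <= term lam i)%N.
Proof.
move=> i0 ij; have [h|h] := leqP j (size lam); last by rewrite term_default.
have /andP[sl _] := partsP lam.
apply: (sorted_leq_nth (leT := geq)) => //; rewrite ?inE; try lia.
- exact: geq_trans.
- by move=> x /=.
Qed.

Lemma conj_termP (lam : int_partition) (i j : nat) :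
  (0 < i)%N -> (0 < j)%N -> (i <= conj_term lam j)%N = (j <= term lam i)%N.
Proof.
move=> i0 j0; rewrite -(count_iota_prefix
  (P := fun i => (j <= term lam i)%N) (m := size lam)) //.
- congr (_ <= _)%N; rewrite /conj_term -{1}(mkseq_nth 0%N lam) /mkseq count_map.
  by rewrite (iotaDl 1 0) count_map.
- by move=> k k0 h; apply: leq_trans h _; apply: term_decr.
- by move=> k; case: (leqP k (size lam)) => // /term_default ->; lia.
Qed.

(** Zero parts are not stored, so the terms also determine the length of the list. *)
Lemma int_partition_eq (lam mu : int_partition) :
  (forall i, (0 < i)%N -> term lam i = term mu i) -> lam = mu.
Proof.
move=> h; apply: val_inj => /=.
have hs : size lam = size mu.
  have e i : (0 < i)%N -> (i <= size lam)%N = (i <= size mu)%N.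
    by move=> i0; rewrite -!term_gt0 // h.
  have := e (size lam); have := e (size mu); rewrite !leqnn.
  by move: (size lam) (size mu) => [|x] [|y]; lia.
apply: (@eq_from_nth _ 0%N) => // i _; exact: (h i.+1).
Qed.

Lemma YP (lam : int_partition) (i j : int) :
  Y lam (i, j) <-> [/\ 0 < i, 0 < j & j <= (term lam `|i|%N)%:Z].
Proof.
split=> [[i' [j' [[-> ->] [h1 h2]]]]|[i0 j0 h]]; first by rewrite absz_nat; split; lia.
exists `|i|%N, `|j|%N; split; first by congr pair; lia.
by have := @term_gt0 lam `|i|%N; lia.
Qed.

(** For [n >= 1], [(row_of c n, col_of c n)] is the [n]-th point of the positive quadrant on the
    diagonal of content [c], counted from the north-west; its smaller coordinate is [n]. *)
Definition row_of (c : int) (n : nat) : nat := (n + `|Num.max (- c) 0|)%N.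
Definition col_of (c : int) (n : nat) : nat := (n + `|Num.max c 0|)%N.

Lemma row_of_diag (i j : int) : 0 < i -> 0 < j ->
  row_of (j - i) `|Num.min i j|%N = `|i|%N.
Proof. rewrite /row_of; lia. Qed.

Lemma col_of_diag (i j : int) : 0 < i -> 0 < j ->
  col_of (j - i) `|Num.min i j|%N = `|j|%N.
Proof. rewrite /col_of; lia. Qed.

(** The [n]-th point of a diagonal lies in row [n] or below, so letting [n] run up to the number of
    rows misses no box. *)
Definition diag_count (lam : int_partition) (c : int) : nat :=
  count (fun n => (col_of c n <= term lam (row_of c n))%N) (iota 1 (size lam)).

Lemma diag_countP (lam : int_partition) (c : int) (n : nat) : (0 < n)%N ->
  (n <= diag_count lam c)%N = (col_of c n <= term lam (row_of c n))%N.
Proof.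
move=> n0; rewrite /diag_count count_iota_prefix //.
- move=> k k0 h; rewrite /col_of /row_of in h *.
  have : (term lam (k.+1 + `|Num.max (- c) 0|) <= term lam (k + `|Num.max (- c) 0|))%N.
    by apply: term_decr; lia.
  lia.
- move=> k; rewrite /col_of /row_of => h.
  have [->//|k0] := posnP k.
  by have := term_gt0 lam (i := (k + `|Num.max (- c) 0|)%N); lia.
Qed.

(** A diagonal meets a diagram in an initial segment, and [Num.min i j] is the position of [(i, j)]
    on its diagonal. *)
Lemma Y_diag (lam : int_partition) (i j : int) :
  Y lam (i, j) <-> [/\ 0 < i, 0 < j & Num.min i j <= (diag_count lam (j - i))%:Z].
Proof.
rewrite YP; split=> -[i0 j0 h]; split=> //.
all: have := @diag_countP lam (j - i) `|Num.min i j|%N.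
all: by rewrite row_of_diag // col_of_diag //; lia.
Qed.

Lemma diag_count_inj (lam mu : int_partition) :
  diag_count lam =1 diag_count mu -> lam = mu.
Proof.
move=> h; have hY i j : Y lam (i, j) <-> Y mu (i, j) by rewrite !Y_diag h.
apply: int_partition_eq => i i0.
have := hY i%:Z (term lam i)%:Z; have := hY i%:Z (term mu i)%:Z.
rewrite !YP !absz_nat.
move=> [h1 h2] [h3 h4].
case: (posnP (term lam i)) => t1; case: (posnP (term mu i)) => t2; first by rewrite t1 t2.
- by case: h2; [split; lia|lia].
- by case: h3; [split; lia|lia].
- by case: h2; [split; lia|]; case: h3; [split; lia|]; lia.
Qed.

(** * Slopes of the diagonal counts *)

Definition unimodal (d : int -> int) : Prop := forall c : int,
  if 0 <= c then d (c + 1) <= d c <= d (c + 1) + 1 else d c <= d (c + 1) <= d c + 1.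

Lemma unimodal_diag_count (lam : int_partition) :
  unimodal (fun c => (diag_count lam c)%:Z).
Proof.
move=> c.
have hY i j i' j' : Y lam (i, j) -> 0 < i' <= i -> 0 < j' <= j -> Y lam (i', j').
  move=> /YP[h1 h2 h3] hi hj; apply/YP; split; try lia.
  by have := @term_decr lam `|i'|%N `|i|%N; lia.
have hd (c0 : int) (n : nat) : (0 < n)%N ->
    ((n <= diag_count lam c0)%N <-> Y lam ((row_of c0 n)%:Z, (col_of c0 n)%:Z)).
  move=> n0; rewrite Y_diag /row_of /col_of.
  by split=> [h|[_ _]]; [split; [lia..|]|]; rewrite (_ : _ - _ = c0); lia.
(* The last box on the diagonal [c1] is compared with a point weakly north-west of it on [c2], at
   the cost of [k] positions. Between neighbouring diagonals one position is always enough, and none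
   is lost when moving towards the main diagonal. *)
have step c1 c2 (k : nat) : (0 < diag_count lam c1 - k)%N ->
   (row_of c2 (diag_count lam c1 - k) <= row_of c1 (diag_count lam c1))%N ->
   (col_of c2 (diag_count lam c1 - k) <= col_of c1 (diag_count lam c1))%N ->
   (diag_count lam c1 <= diag_count lam c2 + k)%N.
  move=> h0 h1 h2; rewrite addnC -leq_subLR; apply/(hd c2) => //.
  apply: (hY (row_of c1 (diag_count lam c1))%:Z (col_of c1 (diag_count lam c1))%:Z).
  - by apply/hd; lia.
  - by rewrite /row_of in h1 *; lia.
  - by rewrite /col_of in h2 *; lia.
have stepr k : k = 1%N \/ k = 0%N /\ c < 0 ->
    (diag_count lam c <= diag_count lam (c + 1) + k)%N.
  have [h _|h hk] := leqP (diag_count lam c) k; first exact: leq_trans (leq_addl _ _).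
  by apply: step; rewrite /row_of /col_of; lia.
have stepl k : k = 1%N \/ k = 0%N /\ 0 <= c ->
    (diag_count lam (c + 1) <= diag_count lam c + k)%N.
  have [h _|h hk] := leqP (diag_count lam (c + 1)) k; first exact: leq_trans (leq_addl _ _).
  by apply: step; rewrite /row_of /col_of; lia.
have := stepr 0%N; have := stepr 1%N; have := stepl 0%N; have := stepl 1%N.
move: (diag_count lam c) (diag_count lam (c + 1)) => x y; clear; case: ifP => hc; lia.
Qed.

Lemma diag_count_eq (lam : int_partition) (c : int) (v : nat) :
  (forall i j : int, 0 < i -> 0 < j -> j - i = c ->
     Y lam (i, j) <-> Num.min i j <= v%:Z) ->
  diag_count lam c = v.
Proof.
move=> h.
have e n : (0 < n)%N -> (n <= diag_count lam c)%N = (n <= v)%N.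
  move=> n0; have := h (row_of c n) (col_of c n); rewrite Y_diag.
  have -> : (col_of c n)%:Z - (row_of c n)%:Z = c by rewrite /row_of /col_of; lia.
  have -> : Num.min (row_of c n)%:Z (col_of c n)%:Z = n%:Z by rewrite /row_of /col_of; lia.
  have r0 : 0 < (row_of c n)%:Z by rewrite /row_of; lia.
  have c0 : 0 < (col_of c n)%:Z by rewrite /col_of; lia.
  by move=> /(_ r0 c0 erefl) [h1 h2]; apply/idP/idP => hn;
    [exact: h1|case: h2].
have := e (diag_count lam c); have := e v; rewrite !leqnn.
by case: (diag_count lam c) (v) => [|x] [|y]; lia.
Qed.

Section Unimodal.
Variables (d : int -> int).
Hypothesis ud : unimodal d.

Lemma unimodal_drop_right (c : int) (n : nat) : d c <= d (c + n%:Z) + n%:Z.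
Proof.
elim: n => [|n IH]; first by rewrite !addr0.
have := ud (c + n%:Z); rewrite (_ : c + n.+1%:Z = c + n%:Z + 1); last lia.
case: ifP; lia.
Qed.

Lemma unimodal_drop_left (c : int) (n : nat) : d c <= d (c - n%:Z) + n%:Z.
Proof.
elim: n => [|n IH]; first by rewrite subr0 addr0.
have := ud (c - n.+1%:Z); rewrite (_ : c - n.+1%:Z + 1 = c - n%:Z); last lia.
case: ifP; lia.
Qed.

Lemma unimodal_right (c c' : int) : 0 <= c -> c <= c' -> d c' <= d c.
Proof.
move=> c0 cc'; rewrite (_ : c' = c + `|(c' - c)%R|%N%:Z); last lia.
elim: `|_|%N => [|n IH]; first by rewrite addr0.
have := ud (c + n%:Z); rewrite (_ : c + n.+1%:Z = c + n%:Z + 1); last lia.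
by case: ifP; lia.
Qed.

Lemma unimodal_left (c c' : int) : c' <= 0 -> c <= c' -> d c <= d c'.
Proof.
move=> c0 cc'; rewrite (_ : c = c' - `|(c' - c)%R|%N%:Z); last lia.
elim: `|_|%N => [|n IH]; first by rewrite subr0.
have := ud (c' - n.+1%:Z); rewrite (_ : c' - n.+1%:Z + 1 = c' - n%:Z); last lia.
by case: ifP; lia.
Qed.

Lemma unimodal_max (c : int) : d c <= d 0.
Proof.
have [c0|c0] := lerP 0 c; first exact: unimodal_right.
by apply: unimodal_left => //; lia.
Qed.

End Unimodal.

(** In a weakly decreasing list the zeros come last, and reading past the end gives zero as well. *)
Lemma nth_filter_gt0 (s : seq nat) (i : nat) :
  sorted geq s -> nth 0%N [seq x <- s | (0 < x)%N] i = nth 0%N s i.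
Proof.
elim: s i => // x s IH i /=; case: ltnP => x0.
  by move=> /path_sorted hs; case: i => //= i; exact: IH.
move=> /(order_path_min geq_trans) /allP hs.
have s0 y : y \in s -> y = 0%N by move=> /hs /=; lia.
rewrite (_ : filter _ s = [::]).
  rewrite nth_nil; case: i => [|i] /=; first lia.
  by have [h|h] := ltnP i (size s); [rewrite (s0 _ (mem_nth _ h))|rewrite nth_default].
by apply/eqP; rewrite -size_eq0 size_filter -leqn0 leqNgt -has_count;
  apply/hasPn => y /s0 ->.
Qed.

Lemma partition_of_terms (g : nat -> nat) (n : nat) :
  (forall i, (0 < i)%N -> (g i.+1 <= g i)%N) ->
  exists lam : int_partition, forall i, (0 < i)%N ->
    term lam i = if (i <= n)%N then g i else 0%N.
Proof.
move=> gd; have sg : sorted geq [seq g i | i <- iota 1 n].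
  apply/(sortedP 0%N) => k; rewrite size_map size_iota => hk.
  have hk' := ltnW hk; rewrite !(nth_map 0%N) ?size_iota // !nth_iota //.
  exact: gd.
have hp : is_int_partition [seq x <- [seq g i | i <- iota 1 n] | (0 < x)%N].
  by rewrite /is_int_partition mem_filter sorted_filter //; exact: geq_trans.
exists (IntPartition hp) => -[//|i] _; rewrite /term /= nth_filter_gt0 //.
have [h|h] := ltnP i n; last by rewrite nth_default // size_map size_iota.
by rewrite (nth_map 0%N) ?size_iota // nth_iota.
Qed.

Lemma term_complement (a b : nat) (lam : int_partition) (i : nat) : (0 < i)%N ->
  term (complement a b lam) i =
    if (i <= a)%N then (b - term lam (a.+1 - i))%N else 0%N.
Proof.
case: i => // i _; rewrite /term /= nth_filter_gt0.
  have [h|h] := ltnP i a; last by rewrite nth_default // size_map size_iota.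
  by rewrite (nth_map 0%N) ?size_iota // nth_iota.
apply/(sortedP 0%N) => k; rewrite size_map size_iota => hk.
have hk' := ltnW hk; rewrite !(nth_map 0%N) ?size_iota // !nth_iota //.
by apply/leq_sub2l/term_decr; lia.
Qed.

(** Row [i] of the partition collects the columns [j] with [Num.min i j <= d (j - i)]. The slope
    condition makes this set of points closed under moves left ([Pj]) and up ([Pup]), and the
    vanishing of [d] outside confines it to [a] rows and [b] columns. *)
Lemma partition_of_diag (d : int -> int) (a b : nat) :
  unimodal d -> (forall c : int, c <= - a%:Z -> d c = 0) ->
  (forall c : int, b%:Z <= c -> d c = 0) ->
  exists lam : int_partition, forall c, (diag_count lam c)%:Z = d c.
Proof.
move=> ud da db.
have d0 c : 0 <= d c.
  have [c0|c0] := lerP 0 c.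
    by rewrite -(db (Num.max c b%:Z)) ?unimodal_right //; lia.
  by rewrite -(da (Num.min c (- a%:Z))) ?unimodal_left //; lia.
(* Slopes have absolute value at most one, so the zeros of [d] at [b] and [- a] bound its values in
   between. *)
have hb : d 0 <= b%:Z by have := unimodal_drop_right ud 0 b; rewrite (db (_ + _)); lia.
have ha : d 0 <= a%:Z by have := unimodal_drop_left ud 0 a; rewrite (da (_ - _)); lia.
have hbc (c : int) : c <= b%:Z -> d c <= b%:Z - c.
  by move=> h; have := unimodal_drop_right ud c `|(b%:Z - c)%R|%N; rewrite (db (_ + _)); lia.
have hac (c : int) : - a%:Z <= c -> d c <= c + a%:Z.
  by move=> h; have := unimodal_drop_left ud c `|(c + a%:Z)%R|%N; rewrite (da (_ - _)); lia.
pose P (i j : nat) := Num.min i%:Z j%:Z <= d (j%:Z - i%:Z).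
have Pj i j : P i j.+1 -> P i j.
  rewrite /P; have := ud (j%:Z - i%:Z).
  by rewrite (_ : j%:Z - i%:Z + 1 = j.+1%:Z - i%:Z); [case: ifP; lia|lia].
have Pup i j : P i.+1 j -> P i j.
  rewrite /P; have := ud (j%:Z - i.+1%:Z).
  by rewrite (_ : j%:Z - i.+1%:Z + 1 = j%:Z - i%:Z); [case: ifP; lia|lia].
have Pb (i j : nat) : (0 < i)%N -> P i j -> (j <= b)%N.
  rewrite /P => i0; have := hbc (j%:Z - i%:Z); have := unimodal_max ud (j%:Z - i%:Z).
  by have := db (j%:Z - i%:Z); lia.
have Pa (i j : nat) : (0 < j)%N -> P i j -> (i <= a)%N.
  rewrite /P => i0; have := hac (j%:Z - i%:Z); have := unimodal_max ud (j%:Z - i%:Z).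
  by have := da (j%:Z - i%:Z); lia.
have hg i j : (0 < i)%N -> (0 < j)%N -> (j <= count (P i) (iota 1 b))%N = P i j.
  by move=> i0 j0; rewrite count_iota_prefix // => k; [move=> _; exact: Pj|exact: Pb].
have [|lam hlam] := @partition_of_terms (fun i => count (P i) (iota 1 b)) a.
  by move=> i i0; apply: sub_count => j; exact: Pup.
exists lam => c; suff -> : diag_count lam c = `|d c|%N by have := d0 c; lia.
apply: diag_count_eq.
move=> i j i0 j0 <-; rewrite YP hlam; last lia.
have := hg `|i|%N `|j|%N; rewrite /P (gtz0_abs i0) (gtz0_abs j0).
have := Pa `|i|%N `|j|%N; rewrite /P (gtz0_abs i0) (gtz0_abs j0).
have := d0 (j - i).
by case: ifP => hi h0 h1 h2; (split=> [[_ _]|h]; [|split=> //]); lia.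
Qed.

Lemma differ_at_diag (lam mu : int_partition) (p : lattice_pt) :
  differ_at lam mu p -> exists2 e : int, e = 1 \/ e = - 1 &
    forall c, (diag_count mu c)%:Z =
      (diag_count lam c)%:Z + if c == p.2 - p.1 then e else 0.
Proof.
have add (nu nu' : int_partition) : ~ Y nu p -> Y nu' = Y nu `|` [set p] ->
    forall c, (diag_count nu' c)%:Z = (diag_count nu c)%:Z + if c == p.2 - p.1 then 1 else 0.
  case: p => i0 j0 /= hn hY c.
  have hYp i j : Y nu' (i, j) <-> Y nu (i, j) \/ (i, j) = (i0, j0) by rewrite hY.
  have : Y nu' (i0, j0) by apply/hYp; right.
  rewrite Y_diag => -[i00 j00 h0].
  have {}hn : ~ Num.min i0 j0 <= (diag_count nu (j0 - i0))%:Z.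
    by move=> h; apply: hn; rewrite Y_diag.
  have [hc|hc] := eqVneq c (j0 - i0); last first.
    rewrite addr0 (@diag_count_eq _ _ (diag_count nu c)) // => i j hi hj hij.
    rewrite hYp Y_diag hij; split=> [[[]//|[ei ej]]|h1]; last by left.
    by move: hc; rewrite -hij ei ej eqxx.
  subst c; rewrite (@diag_count_eq _ _ (diag_count nu (j0 - i0)).+1) //.
    by rewrite -addn1 PoszD.
  (* The boxes of [nu'] on this diagonal form an initial segment reaching [(i0, j0)], so they
     include the first position free in [nu]. The only new box is [(i0, j0)], hence the two
     coincide. *)
  have h1 : Num.min i0 j0 = (diag_count nu (j0 - i0)).+1%:Z.
    set m := diag_count nu (j0 - i0) in hn *.
    have := hYp (row_of (j0 - i0) m.+1) (col_of (j0 - i0) m.+1).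
    rewrite !Y_diag (_ : (col_of _ _)%:Z - _ = j0 - i0); last by rewrite /row_of /col_of; lia.
    have hm : Num.min (row_of (j0 - i0) m.+1)%:Z (col_of (j0 - i0) m.+1)%:Z = m.+1%:Z.
      by rewrite /row_of /col_of; lia.
    rewrite -/m hm => -[h _]; case: h.
    - by split; [rewrite /row_of; lia|rewrite /col_of; lia|lia].
    - by case=> _ _; lia.
    - by case=> e1 e2; rewrite -hm e1 e2.
  move=> i j hi hj hij; rewrite hYp Y_diag hij; split.
    by case=> [[_ _]|[-> ->]]; lia.
  move=> h; have [h2|h2] := lerP (Num.min i j) (diag_count nu (j0 - i0))%:Z; [by left|right].
  by congr pair; lia.
case=> -[hn hY]; [exists 1; [by left|exact: add]|exists (-1); [by right|]].
by move=> c; rewrite (add _ _ hn hY); case: ifP; lia.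
Qed.

Lemma differ_by_square_diag (lam mu : int_partition) : differ_by_square lam mu ->
  exists2 e : int, e = 1 \/ e = - 1 &
    forall c, (diag_count mu c)%:Z =
      (diag_count lam c)%:Z + if c == Delta lam mu then e else 0.
Proof. by move=> [p hp]; apply: differ_at_diag; apply: xgetPex; exists p. Qed.

(** The square to add, in whichever direction the counts grow, is the first free position on the
    diagonal [c0]. *)
Lemma diag_differ_by_square (lam mu : int_partition) (c0 e : int) : e = 1 \/ e = - 1 ->
  (forall c, (diag_count mu c)%:Z =
     (diag_count lam c)%:Z + if c == c0 then e else 0) ->
  differ_by_square lam mu /\ Delta lam mu = c0.
Proof.
move=> e1 h.
have add (nu nu' : int_partition) :
    (forall c, (diag_count nu' c)%:Z = (diag_count nu c)%:Z + if c == c0 then 1 else 0) ->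
    exists2 p, ~ Y nu p & Y nu' = Y nu `|` [set p].
  move=> hd; pose m := diag_count nu c0.
  have hc : (col_of c0 m.+1)%:Z - (row_of c0 m.+1)%:Z = c0 by rewrite /row_of /col_of; lia.
  have hm : Num.min (row_of c0 m.+1)%:Z (col_of c0 m.+1)%:Z = m.+1%:Z.
    by rewrite /row_of /col_of; lia.
  exists ((row_of c0 m.+1)%:Z, (col_of c0 m.+1)%:Z).
    by rewrite Y_diag hc hm -/m => -[_ _]; lia.
  apply/seteqP; split=> -[i j].
    rewrite Y_diag hd => -[i0 j0]; case: eqP => [hij|_].
      rewrite hij -/m => hle; have [h2|h2] := lerP (Num.min i j) m%:Z.
        by left; rewrite Y_diag hij.
      by right; congr pair; rewrite /row_of /col_of in hc hm *; lia.
    by rewrite addr0 => h0; left; rewrite Y_diag.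
  case=> [|[-> ->]]; rewrite !Y_diag hd; first by case=> *; split => //; case: ifP; lia.
  by rewrite hc hm eqxx -/m; split; rewrite /row_of /col_of; lia.
have hdiff : differ_by_square lam mu.
  case: e1 => e1; subst e.
    by have [p h1 h2] := add _ _ h; exists p; left.
  have [|p h1 h2] := add mu lam; last by exists p; right.
  by move=> c; rewrite h; case: ifP; lia.
(* [Delta] is computed from a square obtained by choice; its content is the only place where the
   counts change, hence [c0]. *)
split=> //; have [e' e1' h'] := differ_by_square_diag hdiff.
have := h' c0; rewrite h eqxx; case: eqP => // _; lia.
Qed.

(** * Osculating paths and height functions *)

Definition rank_le (A : {fset int}) (j : int) : nat :=
  count (fun x => x <= j) (labelled A).

Lemma size_labelled (A : {fset int}) : size (labelled A) = #|` A|.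
Proof. by rewrite size_sort. Qed.

Lemma mem_labelled (A : {fset int}) (x : int) : (x \in labelled A) = (x \in A).
Proof. by rewrite mem_sort. Qed.

Lemma labelled_lt_sorted (A : {fset int}) : sorted <%R (labelled A).
Proof. by rewrite sort_lt_sorted fset_uniq. Qed.

Lemma labelled_lt (A : {fset int}) (k k' : nat) :
  (k < k')%N -> (k' < #|` A|)%N -> (labelled A)`_k < (labelled A)`_k'.
Proof.
move=> kk' hk'; rewrite lt_sorted_ltn_nth ?labelled_lt_sorted //.
  by rewrite inE size_labelled (ltn_trans kk').
by rewrite inE size_labelled.
Qed.

Lemma nth_labelled_bounds (n : nat) (A : {fset int}) (k : nat) :
  (A `<=` bracket n)%fset -> (k < #|` A|)%N -> 1 <= (labelled A)`_k <= n%:Z.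
Proof.
move=> /fsubsetP hA hk; rewrite -mem_bracket; apply: hA.
by rewrite -mem_labelled mem_nth // size_labelled.
Qed.

Lemma sorted_nth_le_count (s : seq int) (k : nat) (j : int) :
  sorted <=%R s -> (k < size s)%N ->
  (s`_k <= j) = (k < count (fun x => (x <= j)%R) s)%N.
Proof.
elim: s k => // x s IH k /= hs.
have /allP hx := order_path_min le_trans hs.
have hc : (x <= j) = false -> count (fun y => y <= j) s = 0%N.
  move=> xj; apply/eqP; rewrite -leqn0 leqNgt -has_count; apply/hasPn => y /hx.
  by move=> /= xy; apply: contraFN xj; exact: le_trans.
case: k => [|k] /= hk.
  by case xj: (x <= j) => //=; rewrite hc.
rewrite IH ?(path_sorted hs) //; case xj: (x <= j); first by [].
by rewrite hc.
Qed.

Lemma nth_labelled_le (A : {fset int}) (k : nat) (j : int) :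
  (k < #|` A|)%N -> ((labelled A)`_k <= j) = (k < rank_le A j)%N.
Proof.
by move=> hk; rewrite sorted_nth_le_count ?size_labelled // sort_le_sorted.
Qed.

Lemma rank_le_card (A : {fset int}) (j : int) : (rank_le A j <= #|` A|)%N.
Proof. by rewrite -size_labelled count_size. Qed.

Lemma rank_le_bound (n : nat) (A : {fset int}) (j : int) :
  (A `<=` bracket n)%fset -> 0 <= j -> (rank_le A j)%:Z <= Num.min n%:Z j.
Proof.
move=> hA j0; suff : (rank_le A j <= minn n `|j|)%N by lia.
have <- : size [seq k%:Z | k <- iota 1 (minn n `|j|%N)] = minn n `|j|%N.
  by rewrite size_map size_iota.
rewrite /rank_le -size_filter; apply: uniq_leq_size => [|x].
  by rewrite filter_uniq // sort_uniq fset_uniq.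
rewrite mem_filter mem_labelled => /andP[xj /(fsubsetP hA)]; rewrite mem_bracket => hx.
by apply/mapP; exists `|x|%N; rewrite ?mem_iota; lia.
Qed.

Lemma rank_le_sum (A : {fset int}) (j : int) :
  rank_le A j = (\sum_(0 <= k < #|` A|) ((labelled A)`_k <= j)%R)%N.
Proof.
by rewrite /rank_le -sum1_count big_mkcond /= (big_nth 0) size_labelled.
Qed.

Definition height_function (a b : nat) (alpha beta : {fset int})
    (F : int -> int -> int) : Prop :=
  [/\ forall i : int, 0 <= i <= a%:Z -> F i 0 = 0,
      forall j : int, 0 <= j <= b%:Z -> F 0 j = 0,
      forall i j : int, 0 < i <= a%:Z -> 0 < j <= b%:Z ->
        F (i - 1) j <= F i j <= F (i - 1) j + 1 /\
        F i (j - 1) <= F i j <= F i (j - 1) + 1,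
      forall j : int, 0 <= j <= b%:Z -> F a%:Z j = (rank_le beta j)%:Z
    & forall i : int, 0 <= i <= a%:Z -> F i b%:Z = (rank_le alpha i)%:Z].

(** * Paths as functions of the diagonal *)

Notation origin := ((0, 0) : lattice_pt).

(** Every step raises the content [j - i] by one, from [y - a] at the start to [b - x] at the end,
    so a path is a function of the content. The value is meaningful only on that range. *)
Definition path_row (a : nat) (y : int) (Q : seq lattice_pt) (c : int) : int :=
  (nth origin Q `|(c - (y - a%:Z))%R|%N).1.

Section PathRow.
Variables (a b : nat) (x y : int) (Q : seq lattice_pt).
Hypothesis hQ : Pi a b x y Q.
Let row := path_row a y Q.

Lemma Pi_content (m : nat) : (m < size Q)%N ->
  (nth origin Q m).2 - (nth origin Q m).1 = y - a%:Z + m%:Z.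
Proof.
have [Q0 [Q' [eQ e0 _ /(pathP origin) hst]]] := hQ.
rewrite eQ; elim: m => [|m IH] /= hm; first by rewrite e0 /=; lia.
have := IH (ltnW hm); have := hst m hm.
by rewrite /lattice_step /lattice_pt => /orP[] /eqP -> /=; lia.
Qed.

Lemma Pi_size : (size Q)%:Z = a%:Z + b%:Z - x - y + 1.
Proof.
have [Q0 [Q' [eQ e0 el _]]] := hQ.
have := @Pi_content (size Q').
rewrite eQ /= ltnSn -[size Q']/(size (Q0 :: Q')).-1 nth_last /= el => /(_ isT) /=; lia.
Qed.

Lemma path_row_nth (m : nat) : (m < size Q)%N ->
  nth origin Q m = (row (y - a%:Z + m%:Z), row (y - a%:Z + m%:Z) + (y - a%:Z + m%:Z)).
Proof.
move=> hm; have := Pi_content hm; rewrite /row /path_row.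
rewrite (_ : `|(_ + m%:Z - _)%R|%N = m); last lia.
by case: (nth _ _ _) => u v /= h; congr pair; lia.
Qed.

Lemma path_row_start : row (y - a%:Z) = a%:Z.
Proof.
have [Q0 [Q' [eQ e0 _ _]]] := hQ.
by rewrite /row /path_row subrr eQ e0.
Qed.

Lemma path_row_end : row (b%:Z - x) = x.
Proof.
have [Q0 [Q' [eQ e0 el _]]] := hQ.
have := Pi_size; rewrite /row /path_row /lattice_pt eQ /= => hs.
rewrite (_ : `|(_ - _ - _)%R|%N = size Q').
  by rewrite -[size Q']/(size (Q0 :: Q')).-1 nth_last /= el.
lia.
Qed.

Lemma path_row_step (c : int) : y - a%:Z <= c < b%:Z - x ->
  row (c + 1) = row c \/ row (c + 1) = row c - 1.
Proof.
move=> hc; have [Q0 [Q' [eQ e0 _ /(pathP origin) hst]]] := hQ.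
have := Pi_size; have := hst `|(c - (y - a%:Z))%R|%N.
rewrite /row /path_row /lattice_pt eQ /=.
rewrite (_ : `|(c + 1 - _)%R|%N = `|(c - (y - a%:Z))%R|.+1); last lia.
move=> /= h hs; have := h; rewrite /lattice_step.
by move=> /(_ _)/orP[|/eqP ->|/eqP ->]; [lia|left|right].
Qed.

Lemma path_row_mono (c c' : int) : y - a%:Z <= c -> c <= c' -> c' <= b%:Z - x ->
  row c' <= row c <= row c' + (c' - c).
Proof.
move=> hc cc' hc'.
have {hc'} : c + `|(c' - c)%R|%N%:Z <= b%:Z - x by lia.
rewrite [X in row X <= _ <= row X + (X - _)](_ : c' = c + `|(c' - c)%R|%N%:Z); last lia.
elim: `|_|%N => [|n IH] hn; first by rewrite addr0; lia.
have := @path_row_step (c + n%:Z); rewrite (_ : c + n%:Z + 1 = c + n.+1%:Z); last lia.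
by have := IH; lia.
Qed.

Lemma path_row_bounds (c : int) : y - a%:Z <= c <= b%:Z - x ->
  [/\ x <= row c, row c <= a%:Z, y <= row c + c & row c + c <= b%:Z].
Proof.
move=> hc; have := @path_row_mono (y - a%:Z) c; have := @path_row_mono c (b%:Z - x).
by rewrite path_row_start path_row_end; split; lia.
Qed.

Lemma mem_path_row (i j : int) :
  ((i, j) \in Q) = [&& y - a%:Z <= j - i, j - i <= b%:Z - x & row (j - i) == i].
Proof.
have hs := Pi_size; apply/(nthP origin)/idP => [[m hm]|/and3P[h1 h2 /eqP h3]].
  rewrite path_row_nth // => -[<- <-].
  rewrite [_ + _ - _]addrAC subrr add0r eqxx.
  by move: hm; rewrite -ltz_nat hs; lia.
have hm : (`|(j - i - (y - a%:Z))%R| < size Q)%N by lia.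
exists `|(j - i - (y - a%:Z))%R|%N => //; rewrite path_row_nth //.
by rewrite (_ : _ + `|_|%N%:Z = j - i); [congr pair; lia|lia].
Qed.

End PathRow.

(** The points weakly south-east of the path on the diagonals that it meets; the other diagonals
    contribute nothing. *)
Definition region (a b : nat) (x y : int) (row : int -> int) (i j : int) : bool :=
  [&& y - a%:Z <= j - i, j - i <= b%:Z - x & row (j - i) <= i].

(* The rows of the two paths are compared along each diagonal; an osculation
   forces the upper path away, so that the order is never reversed. *)
Lemma osculating_rows (a b : nat) (x y x' y' : int) (Q Q' : seq lattice_pt) :
  Pi a b x y Q -> Pi a b x' y' Q' -> x < x' -> y < y' -> osculating Q Q' ->
  let row := path_row a y Q in let row' := path_row a y' Q' in
  forall c : int, y' - a%:Z <= c <= b%:Z - x' ->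
    row (c + 1) <= row' c - 1 /\ row (c - 1) <= row' c.
Proof.
move=> hQ hQ' xx' yy' osc row row'.
have hs := Pi_size hQ; have hs' := Pi_size hQ'.
(* At a common point the upper path arrives horizontally and leaves vertically, while the lower one
   leaves horizontally. *)
have touch (c : int) : y' - a%:Z <= c <= b%:Z - x' -> row c = row' c ->
    [/\ row (c + 1) = row c - 1, row (c - 1) = row c
      & c < b%:Z - x' -> row' (c + 1) = row' c].
  move=> hc e.
  have hm : (`|(c - (y - a%:Z))%R| < size Q)%N by lia.
  have hm' : (`|(c - (y' - a%:Z))%R| < size Q')%N by lia.
  have e1 : nth origin Q `|(c - (y - a%:Z))%R|%N = (row c, row c + c).
    by rewrite (path_row_nth hQ) // (_ : _ + `|_|%N%:Z = c) //; lia.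
  have e2 : nth origin Q' `|(c - (y' - a%:Z))%R|%N = (row c, row c + c).
    by rewrite (path_row_nth hQ') // (_ : _ + `|_|%N%:Z = c) ?e //; lia.
  have [[m0 h1] [h2 h3] _ h4] := osc _ _ _ _ hm hm' e1 e2.
  split.
  - have := path_row_nth hQ h2; rewrite h3 => -[-> _].
    by rewrite /row; congr path_row; lia.
  - have hm1 : (`|(c - (y - a%:Z))%R|.-1 < size Q)%N by lia.
    have := path_row_nth hQ hm1; rewrite h1 => -[-> _].
    by rewrite /row; congr path_row; lia.
  - move=> hcx; have hm1 : (`|(c - (y' - a%:Z))%R|.+1 < size Q')%N by lia.
    have := path_row_nth hQ' hm1; rewrite h4 // => -[h5 _].
    by rewrite -e h5 /row'; congr path_row; lia.
have le_row (c : int) : y' - a%:Z <= c <= b%:Z - x' -> row c <= row' c.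
  move=> hc; rewrite (_ : c = y' - a%:Z + `|(c - (y' - a%:Z))%R|%N%:Z); last lia.
  have {hc} : y' - a%:Z + `|(c - (y' - a%:Z))%R|%N%:Z <= b%:Z - x' by lia.
  elim: `|_|%N => [|n IH] hn.
    rewrite addr0 /row' (path_row_start hQ').
    by have [] := path_row_bounds hQ (c := y' - a%:Z); rewrite -/row; lia.
  rewrite (_ : y' - a%:Z + n.+1%:Z = y' - a%:Z + n%:Z + 1); last lia.
  have {}IH : row (y' - a%:Z + n%:Z) <= row' (y' - a%:Z + n%:Z) by apply: IH; lia.
  have := path_row_step hQ (c := y' - a%:Z + n%:Z); rewrite -/row => s1.
  have := path_row_step hQ' (c := y' - a%:Z + n%:Z); rewrite -/row' => s2.
  have := touch (y' - a%:Z + n%:Z); move: IH.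
  rewrite le_eqVlt => /orP[/eqP e|]; last lia.
  by move=> /(_ _ e) []; lia.
move=> c hc; have := le_row c hc; rewrite le_eqVlt => /orP[/eqP e|].
  by have [] := touch c hc e; lia.
have := path_row_step hQ (c := c); have := path_row_step hQ (c := c - 1).
by rewrite -/row (_ : c - 1 + 1 = c); lia.
Qed.

(** Each term [u k.+1] is absorbed by [v k]; only [u 0], which is at most one, is left over. *)
Lemma sum_shift_le (u v : nat -> nat) (r : nat) :
  (forall k, (k < r)%N -> (u k <= 1)%N) ->
  (forall k, (k.+1 < r)%N -> (u k.+1 <= v k)%N) ->
  (\sum_(0 <= k < r) u k <= \sum_(0 <= k < r) v k + 1)%N.
Proof.
case: r => [|r] h1 h2; first by rewrite big_nil.
rewrite big_nat_recl // big_nat_recr //= addnC addnAC.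
apply: leq_trans (leq_addr _ _); apply: leq_add; last exact: h1.
by rewrite !big_nat; apply: leq_sum => k hk; apply: h2.
Qed.

(** * From osculating paths to a height function *)

Section RowFamily.
Variables (a b : nat) (alpha beta : {fset int}) (row : nat -> int -> int).
Let r := #|` alpha|.
Let x k : int := (labelled alpha)`_k.
Let y k : int := (labelled beta)`_k.
Hypothesis hBP : BP a b (alpha, beta).
Hypothesis row_start : forall k, (k < r)%N -> row k (y k - a%:Z) = a%:Z.
Hypothesis row_end : forall k, (k < r)%N -> row k (b%:Z - x k) = x k.
Hypothesis row_step : forall k (c : int), (k < r)%N -> y k - a%:Z <= c < b%:Z - x k ->
  row k (c + 1) = row k c \/ row k (c + 1) = row k c - 1.
Hypothesis row_bounds : forall k (c : int), (k < r)%N -> y k - a%:Z <= c <= b%:Z - x k ->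
  [/\ x k <= row k c, row k c <= a%:Z, y k <= row k c + c & row k c + c <= b%:Z].
Hypothesis row_osc : forall k (c : int), (k.+1 < r)%N ->
  y k.+1 - a%:Z <= c <= b%:Z - x k.+1 ->
  row k (c + 1) <= row k.+1 c - 1 /\ row k (c - 1) <= row k.+1 c.

Lemma labelled_BP_bounds k : (k < r)%N -> 1 <= x k <= a%:Z /\ 1 <= y k <= b%:Z.
Proof.
by case: hBP => /= ha hb hab hk; split; apply: nth_labelled_bounds; rewrite -?hab.
Qed.

Lemma labelled_BP_lt k : (k.+1 < r)%N -> x k < x k.+1 /\ y k < y k.+1.
Proof. by case: hBP => /= ha hb hab hk; split; apply: labelled_lt; rewrite -?hab. Qed.

Let reg k := region a b (x k) (y k) (row k).

(** Translates the inequalities of [row_osc] to regions, in the form that will bound the growth of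
    the height function by one. *)
Lemma region_shift k (i j : int) : (k.+1 < r)%N ->
  reg k.+1 i j -> reg k (i - 1) j && reg k i (j - 1).
Proof.
move=> hk; have [xx yy] := labelled_BP_lt hk.
have := @row_osc k (j - i) hk; rewrite /reg /region.
rewrite (_ : j - (i - 1) = j - i + 1); last lia.
rewrite (_ : j - 1 - i = j - i - 1); last lia.
move: (row k.+1 _) (row k _) (row k _) (x k) (x k.+1) (y k) (y k.+1) xx yy; clear; lia.
Qed.

Lemma region_bounds k (i j : int) : (k < r)%N -> reg k i j -> x k <= i /\ y k <= j.
Proof.
move=> hk /and3P[h1 h2 h3]; have hc : y k - a%:Z <= j - i <= b%:Z - x k by rewrite h1.
by have [h4 _ h5 _] := row_bounds hk hc; lia.
Qed.

Lemma region_mono_row k (i j : int) : (k < r)%N -> i <= a%:Z ->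
  reg k (i - 1) j -> reg k i j.
Proof.
move=> hk hi /and3P[]; rewrite (_ : j - (i - 1) = j - i + 1); last lia.
move=> h1 h2 h3; have := @row_step k (j - i) hk; have := row_start hk.
move=> h4 h5; have h6 : y k - a%:Z <= j - i.
  (* Otherwise [(i - 1, j)] would be on the starting diagonal, where the path is in row [a], below
     row [i - 1]. *)
  rewrite leNgt; apply/negP => h; have e : j - i + 1 = y k - a%:Z by lia.
  by move: h3; rewrite e h4; lia.
by apply/and3P; split; lia.
Qed.

Lemma region_mono_col k (i j : int) : (k < r)%N -> j <= b%:Z ->
  reg k i (j - 1) -> reg k i j.
Proof.
move=> hk hj /and3P[]; rewrite (_ : j - 1 - i = j - i - 1); last lia.
move=> h1 h2 h3; have := @row_step k (j - i - 1) hk; have := row_end hk.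
rewrite (_ : j - i - 1 + 1 = j - i); last lia.
move=> h4 h5; have h6 : j - i <= b%:Z - x k.
  rewrite leNgt; apply/negP => h; have e : j - i - 1 = b%:Z - x k by lia.
  by move: h3; rewrite e h4; lia.
by apply/and3P; split; lia.
Qed.

(** Each region is closed under steps down and right inside the rectangle, so the number of regions
    containing a point does not decrease. The nesting of consecutive regions, fed into
    [sum_shift_le], bounds the increase by one. *)
Lemma region_height_function :
  height_function a b alpha beta (fun i j => (\sum_(0 <= k < r) reg k i j)%N%:Z).
Proof.
have sum0 (u : nat -> bool) : (forall k, (k < r)%N -> ~~ u k) ->
    (\sum_(0 <= k < r) u k)%N%:Z = 0.
  by move=> hu; rewrite big_nat big1 // => k hk; rewrite (negbTE (hu k hk)).
have le_sum (u v : nat -> bool) : (forall k, (k < r)%N -> u k -> v k) ->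
    (\sum_(0 <= k < r) u k <= \sum_(0 <= k < r) v k)%N.
  move=> huv; rewrite !big_nat; apply: leq_sum => k hk.
  by have := huv k hk; case: (u k) => // ->.
split.
- move=> i hi; apply: sum0 => k hk; apply/negP => /(region_bounds hk)[_].
  by have [_ /andP[y0 _]] := labelled_BP_bounds hk => /(le_trans y0).
- move=> j hj; apply: sum0 => k hk; apply/negP => /(region_bounds hk)[+ _].
  by have [/andP[x0 _] _] := labelled_BP_bounds hk => /(le_trans x0).
- move=> i j hi hj; have hia : i <= a%:Z by lia.
  have hjb : j <= b%:Z by lia.
  have m1 := le_sum _ _ (fun k hk => @region_mono_row k i j hk hia).
  have m2 := le_sum _ _ (fun k hk => @region_mono_col k i j hk hjb).
  have b1 k : (k < r)%N -> (reg k i j <= 1)%N by case: reg.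
  have s1 k : (k.+1 < r)%N -> (reg k.+1 i j <= reg k (i - 1)%R j)%N.
    by move=> hk; have := @region_shift k i j hk; case: (reg k.+1) => // /(_ isT)/andP[-> _].
  have s2 k : (k.+1 < r)%N -> (reg k.+1 i j <= reg k i (j - 1)%R)%N.
    by move=> hk; have := @region_shift k i j hk; case: (reg k.+1) => // /(_ isT)/andP[_ ->].
  have h1 := sum_shift_le b1 s1; have h2 := sum_shift_le b1 s2.
  move: (bigop _ _ _) m1 m2 h1 h2 => u; move: (bigop _ _ _) => v; move: (bigop _ _ _) => w.
  by clear; lia.
- move=> j hj; rewrite rank_le_sum; congr Posz.
  have [_ _ <-] := hBP; apply: eq_big_nat => k hk.
  have [hx hy] := labelled_BP_bounds hk; have := @row_bounds k (j - a%:Z) hk.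
  move=> h3; congr nat_of_bool; rewrite /reg /region -/(y k).
  have [hyj|hyj] := boolP (y k <= j); last lia.
  by case: h3; lia.
- move=> i hi; rewrite rank_le_sum; congr Posz.
  apply: eq_big_nat => k hk.
  have [hx hy] := labelled_BP_bounds hk; have := @row_bounds k (b%:Z - i) hk.
  move=> h3; congr nat_of_bool; rewrite /reg /region -/(x k).
  have [hyj|hyj] := boolP (x k <= i); last lia.
  by case: h3; lia.
Qed.

End RowFamily.

Lemma OP_height_function (a b : nat) (alpha beta : {fset int}) P :
  BP a b (alpha, beta) -> OP a b alpha beta P ->
  exists2 F, height_function a b alpha beta F &
    forall i j : int, (paths_through P (i, j))%:Z = F i j - F (i - 1) (j - 1).
Proof.
move=> hBP [sP hP oP].
pose row k := path_row a (labelled beta)`_k (nth [::] P k).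
have hPk k : (k < #|` alpha|)%N ->
    Pi a b (labelled alpha)`_k (labelled beta)`_k (nth [::] P k).
  by move=> hk; apply: hP; rewrite sP.
exists (fun i j => (\sum_(0 <= k < #|` alpha|)
  region a b (labelled alpha)`_k (labelled beta)`_k (row k) i j)%N%:Z).
  apply: region_height_function => //.
  - by move=> k hk; exact: path_row_start (hPk k hk).
  - by move=> k hk; exact: path_row_end (hPk k hk).
  - by move=> k c hk hc; exact: (path_row_step (hPk k hk) hc).
  - by move=> k c hk hc; exact: (path_row_bounds (hPk k hk) hc).
  - move=> k c hk; have [xx yy] := labelled_BP_lt hBP hk.
    have osc : osculating (nth [::] P k) (nth [::] P k.+1) by apply: oP; rewrite sP.
    by move=> hc; exact: (osculating_rows (hPk k (ltnW hk)) (hPk _ hk) xx yy osc hc).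
move=> i j; apply/eqP; rewrite eq_sym subr_eq eq_sym -PoszD eqz_nat; apply/eqP.
rewrite /paths_through -sum1_count big_mkcond /= (big_nth [::]) sP -big_split /=.
apply: eq_big_nat => k hk; rewrite (mem_path_row (hPk k hk)) -/(row k) /region.
(* Both points lie on one diagonal, so their memberships in a region differ exactly when the path is
   in row [i] there. *)
rewrite (_ : j - 1 - (i - 1) = j - i); last lia.
case: (_ <= j - i) => //=; case: (j - i <= _) => //=.
by move: (row k _) => c; have [->|ci] := eqVneq c i; lia.
Qed.

Lemma count_between (m n s : nat) :
  (\sum_(0 <= k < s) ((m <= k) && (k < n)) = minn n s - m)%N.
Proof.
elim: s => [|s IH]; first by rewrite big_nil minn0.
by rewrite big_nat_recr //= IH; lia.
Qed.

(** * From a height function to osculating paths *)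

Section PathsOfHeight.
Variables (a b : nat) (alpha beta : {fset int}) (F : int -> int -> int).
Hypothesis hBP : BP a b (alpha, beta).
Hypothesis hF : height_function a b alpha beta F.
Let r := #|` alpha|.
Let x k : int := (labelled alpha)`_k.
Let y k : int := (labelled beta)`_k.

Lemma height_step (i j : int) : 0 < i <= a%:Z -> 0 < j <= b%:Z ->
  F (i - 1) j <= F i j <= F (i - 1) j + 1 /\ F i (j - 1) <= F i j <= F i (j - 1) + 1.
Proof. by case: hF => _ _ h _ _; exact: h. Qed.

Lemma height_step_row (i j : int) : 0 < i <= a%:Z -> 0 <= j <= b%:Z ->
  F (i - 1) j <= F i j <= F (i - 1) j + 1.
Proof.
move=> hi hj; have [j0|j0] := eqVneq j 0.
  by case: hF => F0 _ _ _ _; rewrite j0 !F0; lia.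
by have [] := @height_step i j hi; lia.
Qed.

Lemma height_step_col (i j : int) : 0 <= i <= a%:Z -> 0 < j <= b%:Z ->
  F i (j - 1) <= F i j <= F i (j - 1) + 1.
Proof.
move=> hi hj; have [i0|i0] := eqVneq i 0.
  by case: hF => _ F0 _ _ _; rewrite i0 !F0; lia.
by have [] := @height_step i j _ hj; lia.
Qed.

Lemma height_mono (i i' j j' : int) : 0 <= i -> i <= i' -> i' <= a%:Z ->
  0 <= j -> j <= j' -> j' <= b%:Z -> F i j <= F i' j'.
Proof.
move=> i0 ii ia j0 jj jb; apply: (@le_trans _ _ (F i' j)).
  have {ia} : i + `|(i' - i)%R|%N%:Z <= a%:Z by lia.
  rewrite [X in _ <= F X _](_ : i' = i + `|(i' - i)%R|%N%:Z); last lia.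
  elim: `|_|%N => [|n IH] hn; first by rewrite addr0.
  have := @height_step_row (i + n.+1%:Z) j.
  by rewrite (_ : i + n.+1%:Z - 1 = i + n%:Z); lia.
have {jb} : j + `|(j' - j)%R|%N%:Z <= b%:Z by lia.
rewrite [X in _ <= F _ X](_ : j' = j + `|(j' - j)%R|%N%:Z); last lia.
elim: `|_|%N => [|n IH] hn; first by rewrite addr0.
have := @height_step_col i' (j + n.+1%:Z).
by rewrite (_ : j + n.+1%:Z - 1 = j + n%:Z); lia.
Qed.

Lemma height_bottom k (j : int) : (k < r)%N -> 0 <= j <= b%:Z ->
  (k%:Z < F a%:Z j) = (y k <= j).
Proof.
move=> hk hj; case: hBP hF => _ _ /= hab [_ _ _ -> // _].
by rewrite nth_labelled_le -?hab.
Qed.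

Lemma height_right k (i : int) : (k < r)%N -> 0 <= i <= a%:Z ->
  (k%:Z < F i b%:Z) = (x k <= i).
Proof. by move=> hk hi; case: hF => _ _ _ _ -> //; rewrite nth_labelled_le. Qed.

Lemma height_le_card (i j : int) : 0 <= i <= a%:Z -> 0 <= j <= b%:Z -> 0 <= F i j <= r%:Z.
Proof.
move=> hi hj; case: (hF) => F0 _ _ _ Fb.
have := @height_mono i a%:Z j b%:Z; have := @height_mono 0 i 0 j.
rewrite F0 ?Fb; try lia.
by have := rank_le_card alpha a; lia.
Qed.

(** The border of the region [F > k]: with [k] counted from 0, a point lies in the region while its
    north-western diagonal neighbour does not. *)
Definition on_path (k : nat) (p : lattice_pt) : bool :=
  [&& 1 <= p.1 <= a%:Z, 1 <= p.2 <= b%:Z & F (p.1 - 1) (p.2 - 1) <= k%:Z < F p.1 p.2].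

(** Follows the border: up as long as the point above still belongs to the region [F > k], otherwise
    right. *)
Definition next_pt (k : nat) (p : lattice_pt) : lattice_pt :=
  if k%:Z < F (p.1 - 1) p.2 then (p.1 - 1, p.2) else (p.1, p.2 + 1).

Definition path_length (k : nat) : nat := `|(a%:Z + b%:Z - x k - y k)%R|%N.

Definition height_path (k : nat) : seq lattice_pt :=
  traject (next_pt k) (a%:Z, y k) (path_length k).+1.

(** Sliding south-east along the diagonal to the bottom row or the right column does not decrease
    [F], and there the condition [F > k] is governed by [y k] or [x k]. *)
Lemma on_path_range k (p : lattice_pt) : (k < r)%N -> on_path k p ->
  y k - a%:Z <= p.2 - p.1 <= b%:Z - x k.
Proof.
case: p => i j hk /and3P[/= hi hj hF'].
have [hx hy] := labelled_BP_bounds hBP hk.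
apply/andP; split; rewrite leNgt; apply/negP => h.
  have := @height_mono i a%:Z j (j + a%:Z - i).
  by have := @height_bottom k (j + a%:Z - i) hk; rewrite -/(y k) in hy *; lia.
have := @height_mono i (i + b%:Z - j) j b%:Z.
by have := @height_right k (i + b%:Z - j) hk; rewrite -/(x k) in hx *; lia.
Qed.

Lemma next_on_path k (p : lattice_pt) : (k < r)%N -> on_path k p -> p.2 - p.1 < b%:Z - x k ->
  on_path k (next_pt k p) /\ (next_pt k p).2 - (next_pt k p).1 = p.2 - p.1 + 1.
Proof.
case: p => i j hk /and3P[/= hi hj hFij] hc.
rewrite /next_pt /=; case: ifP => hn; last first.
  (* In column [b] a right step could be prescribed only at row [x k], that is, at the end of the
     path, which [hc] excludes. *)
  have jb : j <> b%:Z.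
    move=> jb; move: hFij hn; rewrite jb => hFij.
    have := @height_right k i hk; have := @height_right k (i - 1) hk.
    by rewrite -/(x k) in hc *; lia.
  split; last by move=> /=; lia.
  have := @height_step_col i (j + 1); rewrite /on_path /= addrK; lia.
split; last by move=> /=; lia.
have i1 : i <> 1.
  by move=> i1; move: hn; rewrite i1 subrr; case: hF => _ -> //; lia.
have := @height_step_row (i - 1) (j - 1); rewrite /on_path /=; lia.
Qed.

Lemma start_on_path k : (k < r)%N -> on_path k (a%:Z, y k).
Proof.
move=> hk; have [hx hy] := labelled_BP_bounds hBP hk; rewrite -/(x k) -/(y k) in hx hy.
have h1 : (k%:Z < F a%:Z (y k)) = (y k <= y k) by apply: height_bottom => //; lia.
have h2 : (k%:Z < F a%:Z (y k - 1)) = (y k <= y k - 1) by apply: height_bottom => //; lia.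
have h3 : F (a%:Z - 1) (y k - 1) <= F a%:Z (y k - 1) <= F (a%:Z - 1) (y k - 1) + 1.
  by apply: height_step_row; lia.
by apply/and3P; split=> /=; lia.
Qed.

Lemma iter_on_path k m : (k < r)%N -> (m <= path_length k)%N ->
  let p := iter m (next_pt k) (a%:Z, y k) in
  on_path k p /\ p.2 - p.1 = y k - a%:Z + m%:Z.
Proof.
move=> hk; have hr := on_path_range hk (start_on_path hk).
elim: m => [|m IH] hm; first by split; [exact: start_on_path|rewrite /= addr0].
have [h1 h2] := IH (ltnW hm).
have [|h3 h4] := next_on_path hk h1.
  by move: hm hr; rewrite h2 /path_length /=; lia.
by rewrite iterS; split; [|rewrite h4 h2; lia].
Qed.

(** [F] is monotone along a diagonal, so it crosses the value [k] at most once. *)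
Lemma on_path_uniq k (p p' : lattice_pt) : on_path k p -> on_path k p' ->
  p.2 - p.1 = p'.2 - p'.1 -> p = p'.
Proof.
case: p p' => [i j] [i' j'] /and3P[/= hi hj h] /and3P[/= hi' hj' h'] e.
have [ii|ii|ii] := ltgtP i i'; last by congr pair; lia.
  by have := @height_mono i (i' - 1) j (j' - 1); lia.
by have := @height_mono i' (i - 1) j' (j - 1); lia.
Qed.

Lemma size_height_path k : size (height_path k) = (path_length k).+1.
Proof. by rewrite /height_path size_traject. Qed.

Lemma nth_height_path k m : (m <= path_length k)%N ->
  nth origin (height_path k) m = iter m (next_pt k) (a%:Z, y k).
Proof.
by move=> hm; rewrite (set_nth_default (a%:Z, y k)) ?size_traject // nth_traject.
Qed.

Lemma path_length_int k : (k < r)%N -> (path_length k)%:Z = a%:Z + b%:Z - x k - y k.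
Proof.
move=> hk; have := on_path_range hk (start_on_path hk).
by rewrite /path_length /=; lia.
Qed.

Lemma mem_height_path k (p : lattice_pt) : (k < r)%N -> (p \in height_path k) = on_path k p.
Proof.
move=> hk; have hl := path_length_int hk; apply/idP/idP => [/(nthP origin)[m]|hp].
  rewrite size_height_path ltnS => hm <-; rewrite nth_height_path //.
  by have [] := iter_on_path hk hm.
have hr := on_path_range hk hp.
have hm : (`|(p.2 - p.1 - (y k - a%:Z))%R| <= path_length k)%N by lia.
have [h1 h2] := iter_on_path hk hm.
rewrite (on_path_uniq hp h1); last by rewrite h2; lia.
by rewrite -nth_height_path // mem_nth // size_height_path.
Qed.

Lemma height_path_Pi k : (k < r)%N -> Pi a b (x k) (y k) (height_path k).
Proof.
move=> hk; exists (a%:Z, y k), (traject (next_pt k) (next_pt k (a%:Z, y k)) (path_length k)).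
have hl := path_length_int hk; split=> //.
  rewrite last_traject; have [h1 h2] := iter_on_path hk (leqnn _).
  have h3 : (iter (path_length k) (next_pt k) (a%:Z, y k)).2 -
      (iter (path_length k) (next_pt k) (a%:Z, y k)).1 = b%:Z - x k by rewrite h2; lia.
  move: h1 h3; case: (iter _ _ _) => i j /and3P[/= hi hj h] hij.
  have [jb|jb] := eqVneq j b%:Z; first by congr pair; lia.
  (* A column [j < b] would put the endpoint above row [x k], although [F > k] there forces [F > k]
     at [(i, b)], that is, [x k <= i]. *)
  have := @height_mono i i j b%:Z; have := @height_right k i hk.
  by rewrite -/(x k) in hij *; lia.
apply: sub_path (fpath_traject _ _ _) => p p' /eqP <-.
by rewrite /lattice_step /next_pt; case: ifP => _; rewrite eqxx ?orbT.
Qed.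

(** At a common point [F] rises from [k] at [(i - 1, j - 1)] to [k + 2] at [(i, j)], so it equals
    [k + 1] at both intermediate points. These four values decide how each path enters and
    leaves. *)
Lemma height_path_osculating k : (k.+1 < r)%N ->
  osculating (height_path k) (height_path k.+1).
Proof.
move=> hk' pt m m' i j; have hk := ltnW hk'.
rewrite {}/pt !size_height_path !ltnS => hm hm' e e'.
rewrite (nth_height_path hm) in e; rewrite (nth_height_path hm') in e'.
have [h1 hc] := iter_on_path hk hm; have [h1' hc'] := iter_on_path hk' hm'.
rewrite e /= in h1 hc; rewrite e' /= in h1' hc'.
have [hi hj h] : [/\ 1 <= i <= a%:Z, 1 <= j <= b%:Z &
  F (i - 1) (j - 1) <= k%:Z < F i j] by case/and3P: h1.
have h' : F (i - 1) (j - 1) <= k.+1%:Z < F i j by case/and3P: h1'.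
have s1 := @height_step_col (i - 1) j; have s2 := @height_step_row i j.
have s3 := @height_step_row i (j - 1); have s4 := @height_step_col i j.
have eup : F (i - 1) j = k.+1%:Z by lia.
have eleft : F i (j - 1) = k.+1%:Z by lia.
have hl := path_length_int hk.
have pred (k0 n : nat) : (k0 < r)%N -> (n.+1 <= path_length k0)%N ->
    iter n.+1 (next_pt k0) (a%:Z, y k0) = (i, j) ->
    let p := iter n (next_pt k0) (a%:Z, y k0) in on_path k0 p /\
      (p = (i + 1, j) \/ p = (i, j - 1)).
  move=> hk0 hn; rewrite iterS; have [] := iter_on_path hk0 (ltnW hn).
  case: (iter n _ _) => u v h2 _; rewrite /next_pt /=.
  by case: ifP => _ [<- <-]; split=> //; [left|right]; congr pair; lia.
(* The upper path must have a point before and a point after the contact, so it may neither start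
   ([m0]) nor end ([ml]) there. *)
have m0 : (0 < m)%N.
  rewrite lt0n; apply/eqP => m0; move: e; rewrite m0 /= => -[e1 e2].
  by move: eleft; have := @height_bottom k (j - 1) hk; rewrite -e1; lia.
have ml : (m.+1 <= path_length k)%N.
  have jx : j - i <> b%:Z - x k.
    move=> ec; have [jb|jb] := eqVneq j b%:Z.
      have := @height_right k.+1 i hk'; have := labelled_BP_lt hBP hk'.
      by rewrite -jb -/(x k) -/(x k.+1); lia.
    have := @height_right k (i - 1) hk; have := @height_mono (i - 1) (i - 1) j b%:Z.
    by rewrite -/(x k) in ec *; lia.
  by have := on_path_range hk h1; rewrite /=; lia.
split.
- split=> //; rewrite nth_height_path; last lia.
  move: e hm; rewrite -(prednK m0) => e hm.
  have [/and3P[_ _ h2] [e2|e2]] := pred _ _ hk hm e; last by rewrite e2.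
  by move: h2; rewrite e2 /= addrK; lia.
- split; first exact: ml.
  by rewrite nth_height_path // iterS e /next_pt /= eup; case: ifP => //; lia.
- case: m' hm' e' {hc'} => // m' hm' e' _; rewrite nth_height_path /=; last lia.
  have [/and3P[_ _ h2] [e2|e2]] := pred _ _ hk' hm' e'; first by rewrite e2.
  by move: h2; rewrite e2 /=; lia.
- move=> hm2; rewrite nth_height_path //.
  by rewrite iterS e' /next_pt /= eup; case: ifP => //; lia.
Qed.

Lemma height_function_OP : exists2 P, OP a b alpha beta P &
  forall i j : int, 1 <= i <= a%:Z -> 1 <= j <= b%:Z ->
    (paths_through P (i, j))%:Z = F i j - F (i - 1) (j - 1).
Proof.
exists (mkseq height_path r).
  split=> [|k|k]; rewrite size_mkseq // => hk.
    by rewrite nth_mkseq //; exact: height_path_Pi.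
  by rewrite !nth_mkseq ?(ltnW hk) //; exact: height_path_osculating.
move=> i j hi hj.
have := @height_le_card i j; have := @height_le_card (i - 1) (j - 1).
have := @height_mono (i - 1) i (j - 1) j => h1 h2 h3.
rewrite /paths_through -sum1_count big_mkcond /= (big_nth [::]) size_mkseq.
(* The paths through the point are those whose index lies between the two heights; heights never
   exceed [r], so all these indices occur. *)
rewrite (eq_big_nat _ _ (F2 := fun k =>
  ((`|F (i - 1) (j - 1)|%N <= k) && (k < `|F i j|))%N : nat)).
  by rewrite count_between; lia.
move=> k hk; rewrite nth_mkseq // mem_height_path // /on_path /= hi hj /=.
have -> : (F (i - 1) (j - 1) <= k%:Z < F i j) =
  ((`|F (i - 1) (j - 1)|%N <= k) && (k < `|F i j|))%N by lia.
by case: (_ && _).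
Qed.

End PathsOfHeight.

(** * Ordering pairs and signed sums along a progression *)

Definition content (p : lattice_pt) : int := p.2 - p.1.

Definition positive_pt (p : lattice_pt) : bool := (0 < p.1) && (0 < p.2).

Section SignedSums.
Variables (e : lattice_pt -> int).

Definition diag_sum (t : seq lattice_pt) (c : int) : int :=
  \sum_(p <- t | content p == c) e p.

Variable s : seq lattice_pt.

(** On a fixed diagonal, lying weakly north-west of [(i, j)] is a condition on the row alone. *)
Definition corner_sum (i j : int) : int :=
  \sum_(p <- s | (content p == j - i) && (p.1 <= i)) e p.

Lemma corner_sum_row0 (j : int) : {in s, forall p, positive_pt p} ->
  corner_sum 0 j = 0.
Proof.
move=> positive_s; rewrite /corner_sum big_seq_cond big_pred0 // => p.
by apply/negP => /and3P[/positive_s /andP[h1 h2] _ h3]; lia.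
Qed.

Lemma corner_sum_col0 (i : int) : {in s, forall p, positive_pt p} ->
  corner_sum i 0 = 0.
Proof.
move=> positive_s; rewrite /corner_sum big_seq_cond big_pred0 // => p.
by apply/negP => /and3P[/positive_s /andP[h1 h2]]; rewrite /content => /eqP; lia.
Qed.

Lemma corner_sum_rec (i j : int) : uniq s ->
  corner_sum i j = corner_sum (i - 1) (j - 1) + if (i, j) \in s then e (i, j) else 0.
Proof.
move=> us; rewrite /corner_sum (bigID (fun p : lattice_pt => p == (i, j))) /= addrC; congr (_ + _).
  apply: eq_bigl => -[x y]; rewrite /content xpair_eqE /=; lia.
have -> : \sum_(p <- s | (content p == j - i) && (p.1 <= i) && (p == (i, j))) e p =
    \sum_(p <- s | p == (i, j)) e p.
  apply: eq_bigl => p; have [->|] := eqVneq p (i, j); last by rewrite andbF.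
  by rewrite /content /= eqxx lexx.
rewrite -big_filter; case: ifP => hij.
  by rewrite filter_pred1_uniq // big_seq1.
rewrite (_ : filter _ s = [::]) ?big_nil //.
apply/eqP; rewrite -size_eq0 size_filter -leqn0 leqNgt -has_count.
by apply/hasPn => p hp; apply: contraFN hij => /eqP <-.
Qed.

End SignedSums.

(** * The order on points induced by a complete ordering pair *)

Section Order.
Variables (q : int) (prec : rel int).
Hypothesis hprec : q_order q prec.
Let lt := point_lt (Lq q) prec.

(** A point is determined by its level and its content; with the next two lemmas, [Gq] is the
    inverse of this correspondence. *)
Lemma Gq_Lq (p : lattice_pt) : Gq q (Lq q p) (content p) = p.
Proof.
case: p => i j; rewrite /Gq /Lq /content /=.
by do ![case: ifP => ?]; congr pair; lia.
Qed.

Lemma Lq_Gq (u z : int) : Lq q (Gq q u z) = u.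
Proof. by rewrite /Gq /Lq; do ![case: ifP => /= ?]; lia. Qed.

Lemma content_Gq (u z : int) : content (Gq q u z) = z.
Proof. by rewrite /Gq /content; do ![case: ifP => /= ?]; lia. Qed.

Lemma point_lt_irr : irreflexive lt.
Proof. by case: hprec => -[irr _ _] _ p; rewrite /lt /point_lt ltxx eqxx irr. Qed.

Lemma point_lt_trans : transitive lt.
Proof.
case: hprec => -[_ tr _] _ p p' p''; rewrite /lt /point_lt.
move=> /orP[h|/andP[/eqP -> h]] /orP[h'|/andP[/eqP <- h']].
- by rewrite (lt_trans h h').
- by rewrite h.
- by rewrite h'.
- by rewrite eqxx (tr _ _ _ h h') orbT.
Qed.

Lemma point_lt_total (p p' : lattice_pt) : p != p' -> lt p p' || lt p' p.
Proof.
case: hprec => -[_ _ tot] _ ne; rewrite /lt /point_lt.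
case: ltgtP => //= e; apply: tot; apply: contra ne => /eqP e'.
by rewrite -(Gq_Lq p) -(Gq_Lq p') e /content e'.
Qed.

Lemma point_lt_comparable (p p' : lattice_pt) : positive_pt p -> positive_pt p' ->
  p'.1 <= p.1 -> p'.2 <= p.2 -> lt p p' = false.
Proof.
move=> /andP[h1 h2] /andP[h3 h4] h5 h6; apply/negP => h.
by have [_ _ /(_ p p' h1 h2 h3 h4 h)] := complete_ordering_pair hprec; lia.
Qed.

(** Points on the same or on adjacent diagonals are comparable coordinatewise, and the order refines
    that comparison. The points not after [p] are thus those weakly north-west of [p], of the point
    above it, or of the point to its left, according to the diagonal. *)
Lemma point_lt_diag (p x : lattice_pt) : positive_pt p -> positive_pt x ->
  [/\ content x = content p -> ~~ lt p x = (x.1 <= p.1),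
      content x = content p + 1 -> ~~ lt p x = (x.1 <= p.1 - 1)
    & content x = content p - 1 -> ~~ lt p x = (x.1 <= p.1)].
Proof.
move=> hp hx.
have le : x.1 <= p.1 -> x.2 <= p.2 -> ~~ lt p x.
  by move=> h1 h2; rewrite point_lt_comparable.
have ge : p.1 <= x.1 -> p.2 <= x.2 -> (p.1 < x.1) || (p.2 < x.2) -> lt p x.
  move=> h1 h2 h3; have ne : p != x by apply: contraTneq h3 => ->; rewrite !ltxx.
  by have := point_lt_total ne; rewrite (point_lt_comparable hx hp) ?orbF.
rewrite /content; split=> e; apply/idP/idP => h.
all: try by apply: le; lia.
all: by rewrite leNgt; apply: contra h => h; apply: ge; lia.
Qed.

Lemma progressionP (S : {fset lattice_pt}) :
  perm_eq (progression (Lq q) prec S) S /\ sorted lt (progression (Lq q) prec S).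
Proof.
pose R := [set s : seq lattice_pt | perm_eq s S /\ sorted lt s].
suff : exists s, R s by exact: (@xgetPex _ [::] R).
(* Sorting is done with the reflexive closure; the absence of repetitions makes the result strictly
   increasing. *)
pose le (p p' : lattice_pt) := (p == p') || lt p p'.
have le_tr : transitive le.
  move=> y x z /orP[/eqP -> //|h] /orP[/eqP <-|h']; rewrite /le ?h ?orbT //.
  by rewrite (point_lt_trans h h') orbT.
have le_tot : total le.
  move=> x y; rewrite /le eq_sym; have [->|ne] //= := eqVneq y x.
  by rewrite orbC; exact: point_lt_total.
exists (sort le S); split; first by rewrite perm_sort.
apply: pairwise_sorted; have := sort_sorted le_tot S.
rewrite (sorted_pairwise le_tr) => h1.
have := sort_uniq le S; rewrite fset_uniq uniq_pairwise => h2.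
have := pairwise_relI le (fun x y => x != y) (sort le S); rewrite h1 h2 /=.
by apply: sub_pairwise => x y /andP[/orP[/eqP ->|]] //; rewrite eqxx.
Qed.

Lemma progression_unique (S : {fset lattice_pt}) (s : seq lattice_pt) :
  perm_eq s S -> sorted lt s -> progression (Lq q) prec S = s.
Proof.
move=> hs ss; have [h1 h2] := progressionP S.
apply: (irr_sorted_eq point_lt_trans point_lt_irr h2 ss) => p.
by rewrite (perm_mem h1) (perm_mem hs).
Qed.

Lemma point_lt_uniq (s : seq lattice_pt) : sorted lt s -> uniq s.
Proof. exact: sorted_uniq point_lt_trans point_lt_irr s. Qed.

(** The point [p] need not occur in [s]: the growth of a height function is tested at every point of
    the rectangle. *)
Lemma prefix_filter (s : seq lattice_pt) (p : lattice_pt) : sorted lt s ->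
  exists2 n, (n <= size s)%N & [seq x <- s | ~~ lt p x] = take n s.
Proof.
elim: s => [|x t IH] /= hs; first by exists 0%N.
case: ifP => [|/negbFE] hx.
  by have [n hn ->] := IH (path_sorted hs); exists n.+1.
exists 0%N => //; have /allP hall := order_path_min point_lt_trans hs.
apply/eqP; rewrite -size_eq0 size_filter -leqn0 leqNgt -has_count.
by apply/hasPn => y /hall hy; rewrite negbK (point_lt_trans hx hy).
Qed.

Lemma filter_nth_prefix (s : seq lattice_pt) (k : nat) : sorted lt s -> (k < size s)%N ->
  [seq x <- s | ~~ lt (nth origin s k) x] = take k.+1 s.
Proof.
move=> sorted_s hk; rewrite -[X in filter _ X](cat_take_drop k.+1 s) filter_cat.
have lt_nth m n : (m < n)%N -> (n < size s)%N -> lt (nth origin s m) (nth origin s n).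
  move=> mn ns; apply: (sorted_ltn_nth point_lt_trans) => //; rewrite inE //.
  exact: ltn_trans mn ns.
rewrite (all_filterP _); last first.
  apply/(all_nthP origin) => m; rewrite size_takel // => hm; rewrite nth_take //.
  move: hm; rewrite ltnS leq_eqVlt => /orP[/eqP ->|hm]; first by rewrite point_lt_irr.
  by apply/negP => /(point_lt_trans (lt_nth _ _ hm hk)); rewrite point_lt_irr.
rewrite [X in _ ++ X](_ : _ = [::]) ?cats0 //.
apply/eqP; rewrite -size_eq0 size_filter -leqn0 leqNgt -has_count.
apply/(has_nthP origin) => -[m]; rewrite size_drop nth_drop => hm.
by rewrite lt_nth //; lia.
Qed.

Lemma prefix_sums (e : lattice_pt -> int) (s : seq lattice_pt) (p : lattice_pt) :
  {in s, forall p, positive_pt p} -> positive_pt p ->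
  let t := [seq x <- s | ~~ lt p x] in
  [/\ diag_sum e t (content p) = corner_sum e s p.1 p.2,
      diag_sum e t (content p + 1) = corner_sum e s (p.1 - 1) p.2
    & diag_sum e t (content p - 1) = corner_sum e s p.1 (p.2 - 1)].
Proof.
move=> positive_s hp t; rewrite /diag_sum /corner_sum /t.
split; rewrite big_filter_cond big_seq_cond [RHS]big_seq_cond; apply: eq_bigl => x.
all: have [xs|//] := boolP (x \in s); rewrite /= andbC.
all: have [h1 h2 h3] := point_lt_diag hp (positive_s _ xs).
- by rewrite -/(content p); have [/h1 ->|] := eqVneq.
- rewrite (_ : p.2 - (p.1 - 1) = content p + 1); last by rewrite /content; lia.
  by have [/h2 ->|] := eqVneq.
- rewrite (_ : p.2 - 1 - p.1 = content p - 1); last by rewrite /content; lia.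
  by have [/h3 ->|] := eqVneq.
Qed.

End Order.

(** * The shape lambda_{a,b,alpha,beta} *)

(** Rotation by a half turn sends content [c] to [b - a - c], and the difference of the first two
    terms is the number of points of the rectangle on the diagonal [c]. The outer maximum covers
    diagonals that miss the rectangle and partitions that leave it. *)
Lemma diag_count_complement (a b : nat) (mu : int_partition) (c : int) :
  (diag_count (complement a b mu) c)%:Z =
    Num.max (Num.min a%:Z (b%:Z - c) - Num.max (- c) 0
             - (diag_count mu (b%:Z - a%:Z - c))%:Z) 0.
Proof.
set v := Num.max _ _; suff -> : diag_count (complement a b mu) c = `|v|%N by rewrite /v; lia.
apply: diag_count_eq => i j i0 j0 hij; rewrite YP term_complement; last lia.
have hY : 0 < a%:Z + 1 - i -> 0 < b%:Z + 1 - j ->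
    (b%:Z + 1 - j <= (term mu `|(a%:Z + 1 - i)%R|%N)%:Z) =
    (Num.min (a%:Z + 1 - i) (b%:Z + 1 - j) <= (diag_count mu (b%:Z - a%:Z - c))%:Z).
  move=> h1 h2; have e : b%:Z + 1 - j - (a%:Z + 1 - i) = b%:Z - a%:Z - c by lia.
  apply/idP/idP => h.
    by have /Y_diag : Y mu (a%:Z + 1 - i, b%:Z + 1 - j); [apply/YP|rewrite e; case].
  by have /YP : Y mu (a%:Z + 1 - i, b%:Z + 1 - j); [apply/Y_diag; rewrite e|case].
rewrite /v; move: (diag_count mu _) hY => m hY.
have [hi|hi] := leqP `|i|%N a; last by split=> [[_ _]|]; lia.
have [hj|hj] := lerP j b%:Z; last by split=> [[_ _]|]; lia.
move: hY; rewrite (_ : `|(a%:Z + 1 - i)%R|%N = (a.+1 - `|i|)%N); last lia.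
move: (term mu _) => t hY; split=> [[_ _ h]|h]; first lia.
by split=> //; lia.
Qed.

Lemma rank_le_max (n : nat) (A : {fset int}) :
  (A `<=` bracket n)%fset -> rank_le A n%:Z = #|` A|.
Proof.
move=> /fsubsetP hA; rewrite -size_labelled; apply/eqP; rewrite -all_count.
by apply/allP => x; rewrite mem_labelled => /hA; rewrite mem_bracket => /andP[].
Qed.

Lemma rank_le_min (n : nat) (A : {fset int}) (j : int) :
  (A `<=` bracket n)%fset -> j <= 0 -> rank_le A j = 0%N.
Proof.
move=> /fsubsetP hA j0; apply/eqP; rewrite -leqn0 leqNgt -has_count.
by apply/hasPn => x; rewrite mem_labelled => /hA; rewrite mem_bracket; lia.
Qed.

Lemma rank_leS (A : {fset int}) (j : int) :
  (rank_le A j <= rank_le A (j + 1)%R <= (rank_le A j).+1)%N.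
Proof.
have e : rank_le A (j + 1) = (rank_le A j + count_mem (j + 1)%R (labelled A))%N.
  by rewrite /rank_le; elim: (labelled A) => //= x s ->; lia.
by rewrite e count_uniq_mem ?sort_uniq ?fset_uniq //; case: (_ \in _); lia.
Qed.

(** * Diagonal counts in Frobenius notation *)

Section Frobenius.
Variables (a b : nat) (alpha beta : {fset int}).
Hypothesis hBP : BP a b (alpha, beta).
Let gamma : seq int := [seq b%:Z - y | y <- labelled beta].
Let delta : seq int := [seq a%:Z - x | x <- labelled alpha].

Let r : nat := #|` alpha|.
Let x k : int := (labelled alpha)`_k.
Let y k : int := (labelled beta)`_k.

(** The number of diagonal hooks whose arm, or leg if [c < 0], reaches content [c]: [b - y >= c]
    means [y <= b - c], and [a - x >= - c] means [x <= a + c]. *)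
Definition frobenius_diag (c : int) : nat :=
  if 0 <= c then rank_le beta (b%:Z - c) else rank_le alpha (a%:Z + c).

Lemma size_gamma : size gamma = r.
Proof. by case: hBP => _ _ /= e; rewrite size_map size_labelled -e. Qed.

Lemma nth_gamma k : (k < r)%N -> gamma`_k = b%:Z - y k.
Proof. by case: hBP => _ _ /= e hk; rewrite (nth_map 0) ?size_labelled -?e. Qed.

Lemma nth_delta k : (k < r)%N -> delta`_k = a%:Z - x k.
Proof. by move=> hk; rewrite (nth_map 0) ?size_labelled. Qed.

Lemma x_le k (j : int) : (k < r)%N -> (x k <= j) = (k < rank_le alpha j)%N.
Proof. exact: nth_labelled_le. Qed.

Lemma y_le k (j : int) : (k < r)%N -> (y k <= j) = (k < rank_le beta j)%N.
Proof. by case: hBP => _ _ /= e hk; rewrite -nth_labelled_le -?e. Qed.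

Lemma rank_le_r (j : int) : (rank_le alpha j <= r)%N /\ (rank_le beta j <= r)%N.
Proof. by rewrite /r; split; last case: hBP => _ _ /= ->; exact: rank_le_card. Qed.

Lemma frobenius_diag_beta (c : int) : 0 <= c -> frobenius_diag c = rank_le beta (b%:Z - c).
Proof. by rewrite /frobenius_diag => ->. Qed.

Lemma frobenius_diag_alpha (c : int) : c <= 0 -> frobenius_diag c = rank_le alpha (a%:Z + c).
Proof.
move=> c0; rewrite /frobenius_diag; case: ifP => // c0'.
have -> : c = 0 by lia.
by case: hBP => /= ha hb hab; rewrite subr0 addr0 !rank_le_max.
Qed.

(** A box on or right of the main diagonal lies in the hook of its row, so it belongs to [mu] iff
    that hook exists and its arm is long enough. Boxes below are treated by columns through
    [conj_term]. *)
Lemma frobenius_diag_spec (mu : int_partition) :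
  frobenius_spec gamma delta mu -> diag_count mu =1 frobenius_diag.
Proof.
case: (hBP) => /= ha hb hab [hcount hspec] c; rewrite size_gamma in hcount hspec.
have diag i : (0 < i)%N -> (i <= term mu i)%N = (i <= r)%N.
  move=> i0; rewrite -hcount (count_iota_prefix (P := fun i => (i <= term mu i)%N)) //.
  - move=> k k0 h; apply: leq_trans (leqnSn k) _; apply: leq_trans h _.
    exact: term_decr.
  - move=> k h; have [->//|k0] := posnP k.
    by rewrite -term_gt0 //; exact: leq_trans k0 h.
have gi i : (0 < i)%N -> (i <= r)%N ->
    (term mu i)%:Z = i%:Z + b%:Z - y i.-1.
  move=> i0 ir; have [|h _] := hspec i; first by rewrite i0.
  by move: h; rewrite nth_gamma; lia.
have di i : (0 < i)%N -> (i <= r)%N ->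
    (conj_term mu i)%:Z = i%:Z + a%:Z - x i.-1.
  move=> i0 ir; have [|_ h] := hspec i; first by rewrite i0.
  by move: h; rewrite nth_delta; lia.
apply: diag_count_eq => i j i0 j0 hij; rewrite YP.
have [c0|c0] := lerP 0 c.
  rewrite frobenius_diag_beta // (_ : Num.min i j = i); last lia.
  have [_ hr] := rank_le_r (b%:Z - c).
  have := diag `|i|%N; have := gi `|i|%N.
  have := @y_le `|i|.-1 (b%:Z - c).
  by move=> h1 h2 h3; split=> [[_ _ h]|h]; [|split=> //]; lia.
rewrite frobenius_diag_alpha; last lia.
rewrite (_ : Num.min i j = j); last lia.
have [hr _] := rank_le_r (a%:Z + c).
have hY : (`|i| <= conj_term mu `|j|)%N = (`|j| <= term mu `|i|)%N by apply: conj_termP; lia.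
have : (`|j| <= conj_term mu `|j|)%N = (`|j| <= r)%N by rewrite conj_termP ?diag; lia.
have [jr hj|jr hj] := leqP `|j|%N r; last by split=> [[_ _ h]|h]; lia.
have hd : (conj_term mu `|j|)%:Z = `|j|%N%:Z + a%:Z - x `|j|.-1 by apply: di => //; lia.
have hx : (x `|j|.-1 <= a%:Z + c) = (`|j|.-1 < rank_le alpha (a%:Z + c)%R)%N by apply: x_le; lia.
by clear - hY hx hd hij c0 i0 j0; split=> [[_ _ h]|h]; [|split=> //]; lia.
Qed.

(** The partition is built from its prescribed diagonal counts, and its arms and legs are then read
    back. Existence is needed because [frobenius] is defined by choice. *)
Lemma frobenius_exists : exists mu, frobenius_spec gamma delta mu.
Proof.
case: (hBP) => /= ha hb hab.
have [|c hc|c hc|mu hmu] := @partition_of_diag (fun c => (frobenius_diag c)%:Z) a b.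
- move=> c; case: ifP => c0.
    rewrite !frobenius_diag_beta; try lia.
    have := rank_leS beta (b%:Z - (c + 1)).
    by rewrite (_ : b%:Z - (c + 1) + 1 = b%:Z - c); lia.
  rewrite !frobenius_diag_alpha; try lia.
  have := rank_leS alpha (a%:Z + c).
  by rewrite (_ : a%:Z + c + 1 = a%:Z + (c + 1)); lia.
- by rewrite frobenius_diag_alpha ?(rank_le_min ha) //; lia.
- by rewrite frobenius_diag_beta ?(rank_le_min hb) //; lia.
have {}hmu c : diag_count mu c = frobenius_diag c by have := hmu c; lia.
exists mu; split.
  have -> : size gamma = diag_count mu 0.
    by rewrite size_gamma hmu frobenius_diag_alpha // addr0 rank_le_max.
  by apply: eq_count => n; rewrite /row_of /col_of; congr (_ <= term mu _)%N; lia.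
rewrite size_gamma => i /andP[i0 ir].
have hY (k l : int) : 0 < k -> 0 < l ->
    (l <= (term mu `|k|%N)%:Z) = (Num.min k l <= (frobenius_diag (l - k))%:Z).
  move=> k0 l0; have [h1 h2] := Y_diag mu k l; rewrite YP hmu in h1 h2.
  by apply/idP/idP => h; [case: h1|case: h2].
have [x1 y1] : 1 <= x i.-1 <= a%:Z /\ 1 <= y i.-1 <= b%:Z.
  by apply: labelled_BP_bounds => //; lia.
split.
  rewrite nth_gamma; last lia.
  move: (y i.-1) (@y_le i.-1) y1 => v hv y1.
  have g0 : 0 <= b%:Z - v by lia.
  (* Testing the expected last box of row [i] and the box after it pins down the length of the row;
     the leg is found likewise below. *)
  have := hY i%:Z (i%:Z + (b%:Z - v)); have := hY i%:Z (i%:Z + (b%:Z - v) + 1).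
  rewrite absz_nat (_ : i%:Z + (b%:Z - v) - i%:Z = b%:Z - v); last lia.
  rewrite (_ : i%:Z + (b%:Z - v) + 1 - i%:Z = b%:Z - v + 1); last lia.
  rewrite !frobenius_diag_beta; [|lia..].
  rewrite (_ : b%:Z - (b%:Z - v) = v); last lia.
  rewrite (_ : b%:Z - (b%:Z - v + 1) = v - 1); last lia.
  by have := hv v; have := hv (v - 1); lia.
rewrite nth_delta; last lia.
move: (x i.-1) (@x_le i.-1) x1 => v hv x1.
have g0 : 0 <= a%:Z - v by lia.
have := hY (i%:Z + (a%:Z - v)) i%:Z; have := hY (i%:Z + (a%:Z - v) + 1) i%:Z.
rewrite (_ : i%:Z - (i%:Z + (a%:Z - v)) = v - a%:Z); last lia.
rewrite (_ : i%:Z - (i%:Z + (a%:Z - v) + 1) = v - a%:Z - 1); last lia.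
rewrite !frobenius_diag_alpha; [|lia..].
rewrite (_ : a%:Z + (v - a%:Z) = v); last lia.
rewrite (_ : a%:Z + (v - a%:Z - 1) = v - 1); last lia.
have := @conj_termP mu `|(i%:Z + (a%:Z - v))%R|%N i.
have := @conj_termP mu `|(i%:Z + (a%:Z - v) + 1)%R|%N i.
by have := hv v; have := hv (v - 1); lia.
Qed.

(** The diagonals through the bottom row and the right column are all those of the rectangle; on
    them the shape has counts [min - F] for the boundary values of a height function. *)
Lemma lambda_diag :
  [/\ forall j : int, 0 <= j <= b%:Z ->
        (diag_count (lambda_ a b alpha beta) (j - a%:Z))%:Z =
        Num.min a%:Z j - (rank_le beta j)%:Z,
      forall i : int, 0 <= i <= a%:Z ->
        (diag_count (lambda_ a b alpha beta) (b%:Z - i))%:Z =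
        Num.min i b%:Z - (rank_le alpha i)%:Z
    & forall c : int, c <= - a%:Z \/ b%:Z <= c ->
        diag_count (lambda_ a b alpha beta) c = 0%N].
Proof.
case: (hBP) => /= ha hb hab.
have hfr := frobenius_diag_spec (xgetPex empty_part frobenius_exists).
have hc c : (diag_count (lambda_ a b alpha beta) c)%:Z = _ :=
  diag_count_complement a b _ c.
split=> [j hj|i hi|c h]; last by have := hc c; lia.
  rewrite hc hfr frobenius_diag_beta; last lia.
  rewrite (_ : b%:Z - (b%:Z - a%:Z - (j - a%:Z)) = j); last lia.
  (* The rank is at most [j] and at most [r <= a], so the truncation at zero does not act. *)
  have [_ hr] := rank_le_r j; have := rank_le_bound (j := j) hb.
  by have := rank_le_bound (j := a%:Z) ha; rewrite rank_le_max // -/r; lia.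
rewrite hc hfr frobenius_diag_alpha; last lia.
rewrite (_ : a%:Z + (b%:Z - a%:Z - (b%:Z - i)) = i); last lia.
have [hr _] := rank_le_r i; have := rank_le_bound (j := i) ha.
by have := rank_le_bound (j := b%:Z) hb; rewrite rank_le_max // -hab -/r; lia.
Qed.

End Frobenius.

(** * Oscillating tableaux *)

Lemma nth_profile (eta : seq int_partition) (k : nat) : (k.+1 < size eta)%N ->
  (profile eta)`_k = Delta (nth empty_part eta k) (nth empty_part eta k.+1).
Proof.
move=> hk; have hk' : (k < (size eta).-1)%N by lia.
by rewrite /profile (nth_map 0%N) ?size_iota // nth_iota.
Qed.

Lemma size_profile (eta : seq int_partition) : size (profile eta) = (size eta).-1.
Proof. by rewrite /profile size_map size_iota. Qed.

Lemma OT_step (lam : int_partition) (l k : nat) (eta : seq int_partition) :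
  OT lam l eta -> (k < l)%N ->
  exists2 e : int, e = 1 \/ e = - 1 &
    forall c, (diag_count (nth empty_part eta k.+1) c)%:Z =
      (diag_count (nth empty_part eta k) c)%:Z + if c == (profile eta)`_k then e else 0.
Proof.
move=> [hs _ _ hst] hk; rewrite nth_profile; last by rewrite hs.
exact/differ_by_square_diag/(hst k.+1).
Qed.

(** The profile gives the diagonal of each step but not its sign. The sign is forced: adding and
    removing a box there would give slopes differing by two, while the admissible slopes differ by
    at most one. *)
Lemma OT_profile_inj (lam lam' : int_partition) (l : nat) (eta eta' : seq int_partition) :
  OT lam l eta -> OT lam' l eta' -> profile eta = profile eta' -> eta = eta'.
Proof.
move=> h h' hp; have [hs h0 _ _] := h; have [hs' h0' _ _] := h'.
apply: (@eq_from_nth _ empty_part) => [|k]; rewrite ?hs ?hs' // ltnS.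
elim: k => [|k IH] hk; first by rewrite h0 h0'.
apply: diag_count_inj => c.
have [e he hd] := OT_step h hk; have [e' he' hd'] := OT_step h' hk.
have ee : e = e'.
  pose c0 := (profile eta)`_k; have ne : (c0 + 1 == c0) = false by lia.
  have := unimodal_diag_count (nth empty_part eta k.+1) c0.
  have := unimodal_diag_count (nth empty_part eta' k.+1) c0.
  rewrite /= !hd !hd' -hp -IH ?(ltnW hk) // -/c0 eqxx ne.
  by case: ifP; lia.
by have := hd c; have := hd' c; rewrite -hp -IH ?(ltnW hk) // ee; lia.
Qed.

Lemma tableau_ofE (lam : int_partition) (s : seq lattice_pt) (eta : seq int_partition) :
  OT lam (size s) eta -> profile eta = map content s -> tableau_of lam s = eta.
Proof.
move=> h1 h2; pose R := [set eta | OT lam (size s) eta /\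
  profile eta = [seq p.2 - p.1 | p <- s] ].
have [h3 h4] : R (tableau_of lam s) by apply: xgetPex; exists eta.
by apply: OT_profile_inj h3 h1 _; rewrite h4 h2.
Qed.

Lemma diag_count_empty (c : int) : diag_count empty_part c = 0%N.
Proof. by []. Qed.

Lemma diag_sum_take (e : lattice_pt -> int) (s : seq lattice_pt) (k : nat) (c : int) :
  (k < size s)%N ->
  diag_sum e (take k.+1 s) c = diag_sum e (take k s) c +
    if c == content (nth origin s k) then e (nth origin s k) else 0.
Proof.
move=> hk; rewrite /diag_sum (take_nth origin hk) -cats1 big_cat big_cons big_nil /=.
by rewrite eq_sym; case: ifP; rewrite ?addr0.
Qed.

(* The diagonal profile changes only next to the diagonal of the last point,
   where its slopes are the two edge variables leaving that point. *)
Lemma unimodal_prefix (q : int) (prec : rel int) (s : seq lattice_pt)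
    (e : lattice_pt -> int) :
  q_order q prec -> sorted (point_lt (Lq q) prec) s ->
  {in s, forall p, positive_pt p} ->
  (forall i j : int, (i, j) \in s ->
     let F (i j : int) := Num.min i j - corner_sum e s i j in
     F (i - 1) j <= F i j <= F (i - 1) j + 1 /\ F i (j - 1) <= F i j <= F i (j - 1) + 1) ->
  forall k, (k <= size s)%N -> unimodal (diag_sum e (take k s)).
Proof.
move=> hprec hs hpos hF; elim=> [_ c|k IH hk].
  by rewrite take0 /diag_sum !big_nil; case: ifP.
have {}IH := IH (ltnW hk).
set p := nth origin s k; have ps : p \in s by exact: mem_nth.
have [] := prefix_sums hprec e hpos (hpos _ ps).
rewrite (filter_nth_prefix hprec hs hk).
move: (hF p.1 p.2); rewrite -surjective_pairing => /(_ ps).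
move: (hpos _ ps) => /andP[p1 p2] hFp e0 e1 e2 c.
have [ec|nc] := eqVneq c (content p).
  by rewrite ec e0 e1; move: hFp; rewrite /content; case: ifP; lia.
have [ec|nc'] := eqVneq (c + 1) (content p).
  have ec' : c = content p - 1 by lia.
  by rewrite ec e0 ec' e2; move: hFp; rewrite /content; case: ifP; lia.
by have := IH c; rewrite !diag_sum_take // (negbTE nc) (negbTE nc') !addr0.
Qed.

(** The [k]-th partition is the one whose diagonal counts are the signed sums over the first [k]
    points; the next point changes one count by its sign. *)
Lemma tableau_exists (q : int) (prec : rel int) (s : seq lattice_pt)
    (e : lattice_pt -> int) (lam : int_partition) (a b : nat) :
  q_order q prec -> sorted (point_lt (Lq q) prec) s ->
  {in s, forall p, p \in grid a b} ->
  {in s, forall p, e p = 1 \/ e p = - 1} ->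
  (forall i j : int, (i, j) \in s ->
     let F (i j : int) := Num.min i j - corner_sum e s i j in
     F (i - 1) j <= F i j <= F (i - 1) j + 1 /\ F i (j - 1) <= F i j <= F i (j - 1) + 1) ->
  (forall c, (diag_count lam c)%:Z = diag_sum e s c) ->
  exists2 eta, OT lam (size s) eta & profile eta = map content s.
Proof.
move=> hprec hs hgrid he hF hlam.
have hpos : {in s, forall p, positive_pt p}.
  by move=> [i j] /hgrid; rewrite mem_grid /positive_pt /=; lia.
have out k (c : int) : c <= - a%:Z \/ b%:Z <= c -> diag_sum e (take k s) c = 0.
  move=> hc; rewrite /diag_sum big_seq_cond big_pred0 // => -[i j].
  apply/negP => /andP[/mem_take/hgrid]; rewrite mem_grid /content /= => h /eqP; lia.
have hex k : (k <= size s)%N -> exists nu : int_partition,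
    forall c, (diag_count nu c)%:Z = diag_sum e (take k s) c.
  move=> hk; apply: (@partition_of_diag _ a b).
  - exact: (unimodal_prefix hprec hs hpos hF hk).
  - by move=> c hc; apply: out; left.
  - by move=> c hc; apply: out; right.
pose nu k := xget empty_part [set nu : int_partition |
  forall c, (diag_count nu c)%:Z = diag_sum e (take k s) c].
have hnu k c : (k <= size s)%N -> (diag_count (nu k) c)%:Z = diag_sum e (take k s) c.
  by move=> /hex h; have := xgetPex empty_part h; exact.
have hdiff k : (k < size s)%N -> differ_by_square (nu k) (nu k.+1) /\
    Delta (nu k) (nu k.+1) = content (nth origin s k).
  move=> hk; apply: (@diag_differ_by_square _ _ _ (e (nth origin s k))).
    exact/he/mem_nth.
  by move=> c; rewrite !hnu ?diag_sum_take // ltnW.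
exists (mkseq nu (size s).+1).
  split; rewrite ?size_mkseq ?nth_mkseq //.
  - apply: diag_count_inj => c; have := hnu 0%N c (leq0n _).
    by rewrite take0 /diag_sum big_nil diag_count_empty; lia.
  - apply: diag_count_inj => c; have := hnu (size s) c (leqnn _).
    by rewrite take_size -hlam; lia.
  - case=> // k /andP[_ hk]; rewrite !nth_mkseq //=; last by rewrite ltnW.
    by have [] := hdiff k hk.
apply: (@eq_from_nth _ 0) => [|k]; rewrite size_profile size_mkseq ?size_map //= => hk.
rewrite nth_profile ?size_mkseq // !nth_mkseq //; last by rewrite ltnW.
by rewrite (nth_map origin) //; have [] := hdiff k hk.
Qed.

(** * The bijection *)

Lemma mem_Zset (a b : nat) P (p : lattice_pt) :
  (p \in Zset a b P) = (p \in grid a b) && (paths_through P p != 1%N).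
Proof.
rewrite in_fsetU !in_fset !inE /= -andb_orr.
by case: (paths_through P p) => [|[|n]].
Qed.

Lemma grid_positive (a b : nat) (s : seq lattice_pt) :
  {in s, forall p, p \in grid a b} -> {in s, forall p, positive_pt p}.
Proof. by move=> hs [i j] /hs; rewrite mem_grid /positive_pt /=; lia. Qed.

(** For [q = b - a], the rectangle is cut out of the positive quadrant by a bound on the level
    alone. *)
Lemma grid_Lq (a b : nat) (p : lattice_pt) : positive_pt p ->
  (p \in grid a b) = (Lq (b%:Z - a%:Z) p \in bracket (minn a b)).
Proof.
by case: p => i j; rewrite /positive_pt mem_grid mem_bracket /Lq /=; case: ifP; lia.
Qed.

Lemma corner_sum_border (a b : nat) (e : lattice_pt -> int) (s : seq lattice_pt) :
  {in s, forall p, p \in grid a b} ->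
  (forall j : int, corner_sum e s a%:Z j = diag_sum e s (j - a%:Z)) /\
  (forall i : int, corner_sum e s i b%:Z = diag_sum e s (b%:Z - i)).
Proof.
move=> hs; split=> [j|i]; rewrite /corner_sum /diag_sum big_seq_cond [RHS]big_seq_cond.
all: apply: eq_bigl => -[x y]; have [/hs|//] := boolP (_ \in s).
all: by rewrite mem_grid /content /=; lia.
Qed.

Lemma diag_sum_out (a b : nat) (e : lattice_pt -> int) (s : seq lattice_pt) (c : int) :
  {in s, forall p, p \in grid a b} -> c <= - a%:Z \/ b%:Z <= c -> diag_sum e s c = 0.
Proof.
move=> hs hc; rewrite /diag_sum big_seq_cond big_pred0 // => -[i j].
by apply/negP => /andP[/hs]; rewrite mem_grid /content /= => h /eqP; lia.
Qed.

Section Bijection.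
Variables (a b : nat) (alpha beta : {fset int}) (l : nat) (prec : rel int).
Hypothesis hBP : BP a b (alpha, beta).
Let q : int := b%:Z - a%:Z.
Hypothesis hprec : q_order q prec.
Let lam := lambda_ a b alpha beta.

Lemma VOS_tableau (S : {fset lattice_pt}) : VOS a b alpha beta l S ->
  let s := progression (Lq q) prec S in
  [/\ size s = l, {in s, forall p, p \in grid a b} &
      exists2 eta, OT lam (size s) eta & profile eta = map content s].
Proof.
move=> [P [hP hl] hS] s.
have [sS ss] := progressionP hprec S; rewrite -/s in sS ss.
have us : uniq s by exact: (point_lt_uniq hprec ss).
have ms p : (p \in s) = (p \in grid a b) && (paths_through P p != 1%N).
  by rewrite (perm_mem sS) -hS mem_Zset.
have hgrid : {in s, forall p, p \in grid a b} by move=> p; rewrite ms => /andP[].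
have hpos := grid_positive hgrid.
have [F hF hN] := OP_height_function hBP hP.
have [F0 F0' Fst Fb Fr] := hF.
(* This is the sign [+1] at vacancies and [-1] at osculations, and 0 at all other points of the
   rectangle. *)
pose e (p : lattice_pt) : int := 1 - (paths_through P p)%:Z.
have hcorner (n : nat) (i j : int) : 0 <= i <= a%:Z -> 0 <= j <= b%:Z ->
    Num.min i j = n%:Z -> corner_sum e s i j = Num.min i j - F i j.
  elim: n i j => [|n IH] i j hi hj hn.
    have [->|j0] := eqVneq j 0; first by rewrite corner_sum_col0 // F0 //; lia.
    have -> : i = 0 by lia.
    by rewrite corner_sum_row0 // F0' //; lia.
  rewrite corner_sum_rec // (IH (i - 1) (j - 1)); try lia.
  have := hN i j; rewrite ms mem_grid /e.
  case: (paths_through P (i, j)) => [|[|m]] /=; rewrite ?andbF ?andbT => hNij.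
  - by case: ifP; lia.
  - by lia.
  - by case: ifP; lia.
have {}hcorner (i j : int) : 0 <= i <= a%:Z -> 0 <= j <= b%:Z ->
    corner_sum e s i j = Num.min i j - F i j.
  by move=> hi hj; apply: (hcorner `|Num.min i j|%N) => //; lia.
(* Two unit steps lead from [(i - 1, j - 1)] to [(i, j)], so at most two paths share a point. *)
have he (i j : int) : (i, j) \in s -> e (i, j) = 1 \/ e (i, j) = - 1.
  rewrite ms mem_grid /e => /andP[/andP[hi hj] hne]; have := hN i j.
  have := Fst i j; have := height_step_row hF (i := i) (j := j - 1).
  by move: (paths_through _ _) hne => N hne; lia.
split=> //; first by rewrite (perm_size sS) -hS.
apply: (tableau_exists hprec ss hgrid (e := e)).
- by move=> [i j]; exact: he.
- move=> i j /hgrid; rewrite mem_grid => /andP[hi hj] G.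
  rewrite /G !hcorner; try lia.
  by have [] := Fst i j; lia.
move=> c; have [ca|ca] := lerP c (- a%:Z).
  have [_ _ ->] := lambda_diag hBP; last by left.
  by rewrite (diag_sum_out e hgrid) //; left.
have [cb|cb] := lerP b%:Z c.
  have [_ _ ->] := lambda_diag hBP; last by right.
  by rewrite (diag_sum_out e hgrid) //; right.
have [hb hr] := corner_sum_border e hgrid.
have [h1 h2 _] := lambda_diag hBP.
(* A diagonal leaves the rectangle through the bottom row if [c <= b - a], and through the right
   column otherwise. *)
have [cq|cq] := lerP c (b%:Z - a%:Z).
  have -> : c = c + a%:Z - a%:Z by lia.
  by rewrite -hb hcorner ?h1 ?Fb //; lia.
have -> : c = b%:Z - (b%:Z - c) by lia.
by rewrite -hr hcorner ?h2 ?Fr //; lia.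
Qed.

(** As long as the neighbouring diagonal towards 0 has not been visited its count is zero, and by
    unimodality so is the count on [c]; hence no step on [c] can occur. *)
Lemma neighbour_content (eta : seq int_partition) (k : nat) (c : int) :
  OT lam l eta -> (k < l)%N -> (profile eta)`_k = c -> c != 0 ->
  exists2 k', (k' < k)%N & (profile eta)`_k' = if c < 0 then c + 1 else c - 1.
Proof.
move=> h hk hc c0; set c' := if c < 0 then _ else _; apply: contrapT => hno.
have cc' : (c' == c) = false by rewrite /c'; case: ifP; lia.
have hz m : (m <= k)%N -> diag_count (nth empty_part eta m) c' = 0%N.
  elim: m => [_|m IH hm]; first by have [_ -> _ _] := h; exact: diag_count_empty.
  have [e he hd] := OT_step h (leq_trans hm (ltnW hk)).
  have := hd c'; rewrite IH ?(ltnW hm) //; case: eqP => [e1|_]; last lia.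
  by case: hno; exists m.
have [e he hd] := OT_step h hk; rewrite hc in hd.
have hz' : diag_count (nth empty_part eta k.+1) c' = 0%N.
  have := hd c'; case: eqP => [e1|_]; last by rewrite (hz k) //; lia.
  by move: cc'; rewrite e1 eqxx.
have := hd c; rewrite eqxx.
have hzk := hz k (leqnn k).
have := unimodal_diag_count (nth empty_part eta k) (Num.min c c').
have := unimodal_diag_count (nth empty_part eta k.+1) (Num.min c c').
rewrite /=; move: hz' hzk; rewrite /c'; case: ifP => hneg hz1 hz2.
  by rewrite (_ : Num.min c (c + 1) = c) ?hz1 ?hz2; last lia; case: ifP; lia.
rewrite (_ : Num.min c (c - 1) = c - 1); last lia.
rewrite (_ : c - 1 + 1 = c); last lia.
by rewrite hz1 hz2; case: ifP; lia.
Qed.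

(** * Points of a generalized oscillating tableau *)

Section GOTPoints.
Variables (t : seq int) (eta : seq int_partition).
Hypothesis hG : GOT [set` bracket (minn a b)] prec lam l (t, eta).
Let s := [seq Gq q uz.1 uz.2 | uz <- zip t (profile eta)].

Lemma size_GOT : size t = l /\ size (profile eta) = l.
Proof. by case: hG => h1 _ [h2 _ _ _] _; rewrite size_profile h2. Qed.

Lemma size_GOT_points : size s = l.
Proof. by have [h1 h2] := size_GOT; rewrite size_map size_zip h1 h2 minnn. Qed.

Lemma map_Lq_GOT : map (Lq q) s = t.
Proof.
have [h1 h2] := size_GOT; rewrite -map_comp (eq_map (g := fst)).
  by rewrite -/(unzip1 _) unzip1_zip // h1 h2.
by move=> [u z]; exact: Lq_Gq.
Qed.

Lemma map_content_GOT : map content s = profile eta.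
Proof.
have [h1 h2] := size_GOT; rewrite -map_comp (eq_map (g := snd)).
  by rewrite -/(unzip2 _) unzip2_zip // h1 h2.
by move=> [u z]; exact: content_Gq.
Qed.

Lemma nth_GOT_points k : (k < l)%N ->
  Lq q (nth origin s k) = t`_k /\ content (nth origin s k) = (profile eta)`_k.
Proof.
move=> hk; split.
  by rewrite -[in RHS]map_Lq_GOT [RHS](nth_map origin) ?size_GOT_points.
by rewrite -[in RHS]map_content_GOT [RHS](nth_map origin) ?size_GOT_points.
Qed.

Lemma sorted_GOT_points : sorted (point_lt (Lq q) prec) s.
Proof.
apply/(sortedP origin) => k; rewrite size_GOT_points => hk.
have [h1 h2] := nth_GOT_points (ltnW hk); have [h3 h4] := nth_GOT_points hk.
case: hG => _ _ _ /(_ k hk); rewrite /point_lt -h1 -h3 -h2 -h4 /content.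
by case=> [->//|[-> ->]]; rewrite eqxx orbT.
Qed.

(* The first point on a diagonal of content c <> 0 comes after a point on the
   neighbouring diagonal towards 0; the q-order makes its level larger by enough
   for it to lie in the positive quadrant. *)
Lemma positive_GOT_points : {in s, forall p, positive_pt p}.
Proof.
suff hk k : (k < l)%N -> positive_pt (nth origin s k).
  by move=> p /(nthP origin)[k]; rewrite size_GOT_points => /hk + <-.
elim/ltn_ind: k => k IH hk.
have [hL hc] := nth_GOT_points hk.
have hT : 1 <= Lq q (nth origin s k).
  by case: hG => _ /(_ k hk) /=; rewrite mem_bracket hL => /andP[].
have hOT : OT lam l eta by case: hG.
have [e0|ne0] := eqVneq (content (nth origin s k)) 0.
  move: e0 hT; case: (nth _ _ _) => i j; rewrite /content /positive_pt /Lq /=.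
  by case: ifP; lia.
rewrite hc in ne0; have [k' kk' hk'] := neighbour_content hOT hk erefl ne0.
have hk'l := ltn_trans kk' hk.
have pos' := IH k' kk' hk'l.
have [hL' hc'] := nth_GOT_points hk'l; rewrite hk' -hc in hc'.
have hlt : point_lt (Lq q) prec (nth origin s k') (nth origin s k).
  apply: (sorted_ltn_nth (point_lt_trans hprec) _ sorted_GOT_points) => //;
  by rewrite inE size_GOT_points.
have [[irr tr _] hq] := hprec.
(* If the neighbouring content lies between [c] and [q], the [q]-order puts [c] first. The earlier
   point then cannot be on the same level, so the level strictly increases. *)
have asym (z z' : int) : (z < z' <= q) || (q <= z' < z) -> prec z' z = false.
  by move=> /hq h1; apply/negP => h2; have := tr _ _ _ h1 h2; rewrite irr.
move: hlt hT pos' hc' (asym (content (nth origin s k)) (content (nth origin s k'))).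
rewrite /point_lt -!/(content _).
case: (nth _ _ _) => i' j'; case: (nth _ _ _) => i j; rewrite /content /positive_pt /Lq /=.
move: (prec _ _) => pr; case: ifP => q0; case: ifP => c0.
all: move=> h1 h2 h3 h4 h5; lia.
Qed.

Lemma grid_GOT_points : {in s, forall p, p \in grid a b}.
Proof.
move=> p ps; rewrite grid_Lq; last exact: positive_GOT_points.
move: ps => /(nthP origin)[k]; rewrite size_GOT_points => hk <-.
by have [-> _] := nth_GOT_points hk; case: hG => _ /(_ k hk).
Qed.

Lemma Phi_GOT : perm_eq s (Phi q (t, eta)).
Proof.
apply: uniq_perm; rewrite ?fset_uniq //.
  exact: (point_lt_uniq hprec sorted_GOT_points).
move=> p; apply/mapP/imfsetP => /= -[uz huz ->]; by exists uz.
Qed.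

Lemma Theta_Phi : Theta a b alpha beta (Lq q) prec (Phi q (t, eta)) = (t, eta).
Proof.
rewrite /Theta (progression_unique hprec Phi_GOT sorted_GOT_points).
rewrite map_Lq_GOT (tableau_ofE (eta := eta)) ?map_content_GOT //.
by rewrite size_GOT_points; case: hG.
Qed.

(** The signs are read from the tableau, so that their prefix sums are the diagonal counts of its
    partitions. This makes [F] a height function, and the paths it defines have the points of [s] as
    vacancies and osculations. *)
Lemma VOS_Phi : VOS a b alpha beta l (Phi q (t, eta)).
Proof.
have hOT : OT lam l eta by case: hG.
have ss := sorted_GOT_points; have us : uniq s by exact: (point_lt_uniq hprec ss).
have hpos := positive_GOT_points; have hgrid := grid_GOT_points.
pose dg k c : int := (diag_count (nth empty_part eta k) c)%:Z.
pose e (p : lattice_pt) : int := dg (index p s).+1 (content p) - dg (index p s) (content p).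
have he : {in s, forall p, e p = 1 \/ e p = - 1}.
  move=> p ps; have hi : (index p s < l)%N by rewrite -size_GOT_points index_mem.
  have [e' he' hd] := OT_step hOT hi.
  have [_] := nth_GOT_points hi; rewrite nth_index // => hc.
  by rewrite /e /dg hd hc eqxx; lia.
have hsum k c : (k <= l)%N -> diag_sum e (take k s) c = dg k c.
  elim: k => [_|k IH hk].
    by rewrite take0 /diag_sum big_nil /dg; case: hOT => _ -> _ _.
  rewrite diag_sum_take ?size_GOT_points // IH ?(ltnW hk) //.
  have [e' he' hd] := OT_step hOT hk; have [_ hc] := nth_GOT_points hk.
  rewrite /e index_uniq ?size_GOT_points // hc.
  rewrite [dg k.+1 c]/dg hd -/(dg k c); case: eqP => [->|//].
  by rewrite /dg hd eqxx; lia.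
pose F (i j : int) : int := Num.min i j - corner_sum e s i j.
have hF : height_function a b alpha beta F.
  have [hb hr] := corner_sum_border e hgrid; have [h1 h2 _] := lambda_diag hBP.
  have hfin c : diag_sum e s c = (diag_count lam c)%:Z.
    have := hsum l c (leqnn l); rewrite -{1}size_GOT_points take_size => ->.
    by rewrite /dg; case: hOT => _ _ -> _.
  split.
  - by move=> i hi; rewrite /F corner_sum_col0 //; lia.
  - by move=> j hj; rewrite /F corner_sum_row0 //; lia.
  - move=> i j hi hj; have hp : positive_pt (i, j) by rewrite /positive_pt /=; lia.
    (* The point [(i, j)] cuts off a prefix of [s]; the slopes of the corresponding partition on
       both sides of content [j - i] are the required growth of [F]. *)
    have [n hn en] := prefix_filter hprec (i, j) ss; rewrite size_GOT_points in hn.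
    have [] := prefix_sums hprec e hpos hp; rewrite en !hsum // /content /= => d0 d1 d2.
    have := unimodal_diag_count (nth empty_part eta n) (j - i).
    have := unimodal_diag_count (nth empty_part eta n) (j - i - 1).
    rewrite /= -!/(dg _ _) (_ : j - i - 1 + 1 = j - i); last lia.
    by rewrite d0 d1 d2 /F; do 2![case: ifP => ?]; lia.
  - by move=> j hj; rewrite /F hb hfin h1 //; lia.
  - by move=> i hi; rewrite /F hr hfin h2 //; lia.
have [P hP hN] := height_function_OP hBP hF.
(* A diagonal step raises [Num.min i j] by one, so the number of paths through a point is one minus
   its sign on [s], and exactly one off [s]. *)
have memZ (i j : int) : ((i, j) \in Zset a b P) = ((i, j) \in s).
  rewrite mem_Zset; apply/andP/idP => [[hg hne]|hs].
    move: hg hne; rewrite mem_grid => /andP[hi hj]; have := hN i j hi hj.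
    rewrite /F (corner_sum_rec e i j us); case: ifP => //= _.
    by move: (paths_through _ _) => N; lia.
  have hg := hgrid _ hs; split=> //; move: hg; rewrite mem_grid => /andP[hi hj].
  have := hN i j hi hj; have := he _ hs.
  rewrite /F (corner_sum_rec e i j us) hs.
  by move: (paths_through _ _) => N; lia.
have eZ : Zset a b P = Phi q (t, eta).
  apply/fsetP => -[i j]; rewrite -(perm_mem Phi_GOT); exact: memZ.
exists P => //; split=> //.
by rewrite eZ -(perm_size Phi_GOT) size_GOT_points.
Qed.

End GOTPoints.

Lemma Theta_GOT (S : {fset lattice_pt}) : VOS a b alpha beta l S ->
  let te := Theta a b alpha beta (Lq q) prec S in
  GOT [set` bracket (minn a b)] prec lam l te /\ Phi q te = S.
Proof.
move=> hS; have [hl hgrid [eta h1 h2]] := VOS_tableau hS.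
have [sS ss] := progressionP hprec S.
rewrite /Theta (tableau_ofE h1 h2); set s := progression _ _ _ in hl hgrid h1 h2 sS ss *.
split.
  split; rewrite ?size_map -?hl // => k hk.
    rewrite (nth_map origin) //= -grid_Lq; first exact/hgrid/mem_nth.
    exact/(grid_positive hgrid)/mem_nth.
  rewrite !(nth_map origin) ?(ltnW hk) // h2 !(nth_map origin) ?(ltnW hk) //.
  have := (sortedP origin ss) k hk; rewrite /point_lt => /orP[|/andP[/eqP]]; by [left|right].
apply/fsetP => p; rewrite -(perm_mem sS) /Phi /= h2.
apply/imfsetP/idP => /= [[uz]|ps].
  by rewrite zip_map => /mapP[x xs ->] -> /=; rewrite (Gq_Lq q).
exists (Lq q p, content p); last by rewrite /= Gq_Lq.
by rewrite zip_map; apply/mapP; exists p.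
Qed.

End Bijection.

Theorem theorem13 (a b : nat) (ha : (0 < a)%N) (hb : (0 < b)%N)
    (alpha beta : {fset int}) (hBP : BP a b (alpha, beta)) (l : nat)
    (prec : rel int) (hprec : q_order (b%:Z - a%:Z) prec) :
  let q := b%:Z - a%:Z in
  let V := VOS a b alpha beta l in
  let G := GOT [set` bracket (minn a b)] prec (lambda_ a b alpha beta) l in
  let Th := Theta a b alpha beta (Lq q) prec in
  [/\ set_bij V G Th,
      set_fun G V (Phi q),
      forall S, V S -> Phi q (Th S) = S
    & forall te, G te -> Th (Phi q te) = te].
Proof.
move=> q V G Th.
have ThG S : V S -> G (Th S) by move=> /(Theta_GOT hBP hprec)[].
have PhiTh S : V S -> Phi q (Th S) = S by move=> /(Theta_GOT hBP hprec)[].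
have PhiV te : G te -> V (Phi q te) by case: te => t eta; exact: VOS_Phi.
have ThPhi te : G te -> Th (Phi q te) = te by case: te => t eta; exact: Theta_Phi.
split=> //; split=> //.
- move=> S S' /set_mem hS /set_mem hS' e.
  by rewrite -(PhiTh _ hS) -(PhiTh _ hS') e.
- by move=> te hte; exists (Phi q te); [exact: PhiV|exact: ThPhi].
Qed.
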